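(* Let $G=(V,E)$ be a locally finite, connected graph with graph metric $d$. Then $G$ (i.e. the metric space $(V,d)$) admits a coarse embedding into a Hilbert space if and only if for every $p<1$ there exists a general bond percolation $\mathbf{P}$ on $G$, with configuration denoted $\omega$, such that $\mathbf{P}[e\in\omega]>p$ for every $e\in E$ and such that the two-point function vanishes at infinity, i.e. $$\lim_{r\to\infty}\ \sup_{\substack{u,v\in V\\ d(u,v)>r}}\ \mathbf{P}[u\leftrightarrow v]=0 .$$
   Context: Graphs have a vertex set $V$ and a set $E$ of undirected edges $[u,v]$. A graph is locally finite if every vertex has finite degree. For a connected graph, $d(u,v)$ is the length of a shortest path joining $u$ and $v$. A map $f\colon X\to Y$ between metric spaces is a coarse embedding if there exist non-decreasing maps $\rho_1,\rho_2\colon[0,\infty)\to[0,\infty)$ such that $\rho_1(t)\to\infty$ as $t\to\infty$ and $\rho_1(d_X(u,v))\le d_Y(f(u),f(v))\le\rho_2(d_X(u,v))$ for all $u,v\in X$. $G$ admits a coarse embedding into a Hilbert space if there is a Hilbert space $H$ and a coarse embedding $(V,d)\to H$. A general bond percolation on $G$ is a probability measure $\mathbf{P}$ on subsets of $E$, i.e. on $\{0,1\}^E$ with its Borel $\sigma$-algebra (no invariance or independence is assumed). The configuration $\omega\subset E$ is identified with the induced subgraph of $G$ with vertex set $V$ and edge set $\omega$; its connected components are called clusters. $\{u\leftrightarrow v\}$ is the event that $u$ and $v$ lie in the same cluster of $\omega$; the function $\tau(u,v)=\mathbf{P}[u\leftrightarrow v]$ is the two-point function. A supremum over an empty set of pairs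 is taken to be $0$. *)

(* Defs.v *)
From HB Require Import structures.
From mathcomp Require Import all_boot all_order all_algebra.
From mathcomp Require Import all_classical all_reals all_analysis.
Import Order.TTheory GRing.Theory Num.Theory.
Import numFieldNormedType.Exports.

Set Implicit Arguments.
Unset Strict Implicit.
Unset Printing Implicit Defensive.

Local Open Scope classical_set_scope.
Local Open Scope ring_scope.

(* An undirected edge [u, v] is the set {u, v}. Loops ({u, u} = {u}) are not
   excluded; parallel edges are. *)
Record graph (V : Type) := Graph {
  edges : set (set V);
  edges_pair : forall e, edges e -> exists u v, e = [set u; v] }.

Section Graphs.
Context {V : Type} (G : graph V).

Definition adj : rel V := fun u v => [set u; v] \in edges G.

(* u :: s is a path from u to v, of length [size s]. Vertices may repeat, which
   changes neither connectedness nor the length of a shortest path. *)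
Definition is_path (u v : V) (s : seq V) : Prop := path adj u s /\ last u s = v.

Definition same_component (u v : V) : Prop := exists s, is_path u v s.

Definition graph_connected : Prop := forall u v, same_component u v.

Definition locally_finite : Prop :=
  forall u, finite_set [set e | edges G e /\ e u].

(* The junk value 0 is taken when no path joins u to v. *)
Definition gdist (u v : V) : nat :=
  xget 0%N [set n | (exists2 s, is_path u v s & size s = n) /\
                    (forall s, is_path u v s -> (n <= size s)%N)].

End Graphs.

Section CoarseEmbeddings.
Context {R : realType}.

(* rho restricts to a non-decreasing map [0, oo) -> [0, oo). *)
Definition control_function (rho : R -> R) : Prop :=
  (forall t, 0 <= t -> 0 <= rho t) /\
  (forall s t, 0 <= s -> s <= t -> rho s <= rho t).

Definition coarse_embedding {X Y : Type} (dX : X -> X -> R) (dY : Y -> Y -> R)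
    (f : X -> Y) : Prop :=
  exists rho1 rho2 : R -> R,
    [/\ control_function rho1, control_function rho2,
        rho1 t @[t --> +oo] --> +oo &
        forall u v, rho1 (dX u v) <= dY (f u) (f v) <= rho2 (dX u v)].

(* The norm of H is the one induced by the inner product. *)
Definition is_hilbert_product (H : completeNormedModType R)
    (ip : {dot H for @idfun R}) : Prop :=
  forall x, `|x| ^+ 2 = ip x x.

(* Only the metric of the Hilbert space matters, so complex Hilbert spaces
   are covered through their underlying real ones. *)
Definition hilbert_coarsely_embeddable {X : Type} (dX : X -> X -> R) : Prop :=
  exists (H : completeNormedModType R) (ip : {dot H for @idfun R}),
    is_hilbert_product ip /\
    exists f : X -> H, coarse_embedding dX (fun x y => `|x - y|) f.

End CoarseEmbeddings.

Section Percolation.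
Context {V : Type} (G : graph V).

Definition cfg_space := {ptws edges G -> bool}.

Definition configuration := g_sigma_algebraType (@open cfg_space).

Definition open_edges (w : configuration) : set (set V) :=
  [set \val e | e in [set e : edges G | w e]].

Lemma open_edges_pair (w : configuration) (e : set V) :
  open_edges w e -> exists u v, e = [set u; v].
Proof. by case=> -[e' /= e'G] _ <-; apply: edges_pair; exact/set_mem/e'G. Qed.

Definition open_subgraph (w : configuration) : graph V :=
  Graph (@open_edges_pair w).

Definition same_cluster (w : configuration) (u v : V) : Prop :=
  same_component (open_subgraph w) u v.

Definition two_point {R : realType} (P : probability configuration R)
    (u v : V) : R :=
  fine (P [set w | same_cluster w u v]).

(* [sup] on R sends the empty set to 0, as wanted. *)
Definition vanishes_at_infinity {R : realType} (tau : V -> V -> R) : Prop :=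
  sup [set t | exists u v, r < (gdist G u v)%:R /\ t = tau u v]
    @[r --> (+oo : set_system R)] --> (0 : R).

End Percolation.

(* Main.v *)
From HB Require Import structures.
Require Import Defs.
From mathcomp Require Import all_boot all_order all_algebra.
From mathcomp Require Import all_classical all_reals all_analysis.
From mathcomp Require Import ring lra.
Import Order.TTheory GRing.Theory Num.Theory.
Import numFieldNormedType.Exports.

Set Implicit Arguments.
Unset Strict Implicit.
Unset Printing Implicit Defensive.

Local Open Scope classical_set_scope.
Local Open Scope ring_scope.

(** Both implications translate between percolations and kernels on the
    vertex set, which is countable since the graph is connected and locally
    finite.

    From percolations to an embedding. For a fixed configuration, being in
    the same cluster is an equivalence relation, so the two-point function is
    an expectation of positive semi-definite kernels, hence positive
    semi-definite ([psd_two_point]). Choose percolations with edge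
    probabilities above [1 - 2 ^- n.+1] and add up their disconnection
    probabilities. The sum is at most the graph distance, by a union bound
    along geodesics ([two_point_gdist]), and it tends to infinity with the
    distance, because each term tends to 1. It is a conditionally negative
    definite kernel, so half a squared Hilbert distance ([psd_realisation]).
    The Hilbert space is the space [ell2] of square-summable sequences, built
    here with its completeness, and the vectors come from iterated Schur
    complements, the kernel form of Gram-Schmidt ([gram_vectors]); each
    vector has finitely many non-zero coordinates.

    From an embedding to percolations. The same Gram vectors replace the
    given Hilbert space by finitely supported sequences [c u]. Averaging
    [|g u - g v|] over the sums [g u] of the coordinates of [c u] with random
    signs gives, by Khinchine's inequality, a quantity comparable with the
    Hilbert distance ([signed_sums_first_moment_ge],
    [signed_sums_first_moment_le]). It is moreover a mixture of cut metrics,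
    the cuts being [g > threshold]. Choose these cuts independently, with
    Poisson rates proportional to [lambda], and close the edges that cross a
    chosen cut. Then [u] and [v] are on the same side of all chosen cuts with
    probability about [exp (- lambda |g u - g v|)], the absolute value being
    averaged ([uncut_prob_poisson_cuts]). This is close to 1 on edges for
    small [lambda], tends to 0 as the Hilbert distance grows, and bounds the
    two-point function, since a path in the configuration crosses no chosen
    cut.

    Finitely many coordinates and thresholds only give finite approximations.
    They are passed to the limit along an ultrafilter on the clopen sets of
    [{0, 1} ^ E]; by compactness the resulting finitely additive function is
    a premeasure, and it extends to a Borel probability
    ([clopen_content_extension], [percolation_limit]). Connection events are
    open, and are exhausted by the clopen events that use one of finitely
    many paths ([cut_percolation]). *)

(** * Positive semi-definite kernels and Gram vectors *)

Section Kernels.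
Context {R : realType} {X : Type}.
Implicit Types (K : X -> X -> R) (s : seq (R * X)).

Definition quad_form K s : R :=
  \sum_(x <- s) \sum_(y <- s) x.1 * y.1 * K x.2 y.2.

Definition psd_kernel K : Prop :=
  (forall u v, K u v = K v u) /\ forall s, 0 <= quad_form K s.

Lemma quad_form_cons K t p s : (forall u v, K u v = K v u) ->
  quad_form K ((t, p) :: s) =
  t ^+ 2 * K p p + 2 * t * (\sum_(x <- s) x.1 * K x.2 p) + quad_form K s.
Proof.
move=> symK; rewrite /quad_form !big_cons /=.
under [X in _ + X = _]eq_bigr do rewrite big_cons /=.
rewrite big_split /= !addrA; congr (_ + _).
rewrite -addrA expr2; congr (_ + _).
rewrite -mulrA mulr_sumr mulr_sumr -big_split /=; apply: eq_bigr => x _.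
by rewrite (symK p); ring.
Qed.

(** The kernel left after projecting out the point [p]. When [K p p = 0] the
    division yields 0 and [K] is left unchanged. *)
Definition schur_complement K p u v := K u v - K u p * K p v / K p p.

Lemma psd_kernel_ge0 K p : psd_kernel K -> 0 <= K p p.
Proof.
case=> _ /(_ [:: (1, p)]); rewrite /quad_form !big_seq1 /=.
by rewrite !mul1r.
Qed.

(** Otherwise the form at [(t, p), (1, u)] would be a non-constant affine
    function of [t], hence negative somewhere. *)
Lemma psd_kernel_null K p u : psd_kernel K -> K p p = 0 -> K p u = 0.
Proof.
move=> [symK psdK] Kpp.
have quad t : 0 <= K u u + t * K p u.
  have := psdK [:: (t / 2, p); (1, u)].
  rewrite quad_form_cons// Kpp /quad_form !big_seq1/= (symK u p).
  by congr (_ <= _); field.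
have [//|Kpu0] := eqVneq (K p u) 0.
have := quad (- (K u u + 1) / K p u).
by rewrite divfK//; lra.
Qed.

Lemma quad_form_schur K p s : (forall u v, K u v = K v u) ->
  quad_form (schur_complement K p) s =
  quad_form K s - (\sum_(x <- s) x.1 * K x.2 p) ^+ 2 / K p p.
Proof.
move=> symK; rewrite /quad_form expr2 mulr_suml mulr_suml -sumrB.
apply: eq_bigr => x _; rewrite mulr_sumr mulr_suml -sumrB.
by apply: eq_bigr => y _; rewrite /schur_complement (symK p); ring.
Qed.

(** The quadratic form of the complement at [s] is the minimum over [t] of the
    quadratic form of [K] at [(t, p) :: s]. *)
Lemma psd_schur_complement K p :
  psd_kernel K -> psd_kernel (schur_complement K p).
Proof.
move=> psdK; have [symK posK] := psdK; split=> [u v|s].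
  by rewrite /schur_complement symK (symK u p) (symK p v) (mulrC (K p u)).
rewrite quad_form_schur//; set L := \sum_(x <- s) _.
have [Kpp|Kpp] := eqVneq (K p p) 0; first by rewrite Kpp invr0 mulr0 subr0.
have := posK ((- L / K p p, p) :: s); rewrite quad_form_cons// -/L.
congr (_ <= _); by field.
Qed.

Lemma schur_complement_pivot K p u :
  psd_kernel K -> schur_complement K p p u = 0.
Proof.
move=> psdK; rewrite /schur_complement.
have [Kpp|Kpp] := eqVneq (K p p) 0.
  by rewrite Kpp invr0 mulr0 subr0 psd_kernel_null.
by rewrite mulrAC divff// mul1r subrr.
Qed.

Lemma schur_complement_null K p q u :
  (forall v, K q v = 0) -> schur_complement K p q u = 0.
Proof. by move=> Kq; rewrite /schur_complement !Kq !mul0r subr0. Qed.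

Fixpoint schur_iter K (e : nat -> X) n :=
  if n is m.+1 then schur_complement (schur_iter K e m) (e m) else K.

Lemma psd_schur_iter K e n : psd_kernel K -> psd_kernel (schur_iter K e n).
Proof. by move=> psdK; elim: n => //= n; exact: psd_schur_complement. Qed.

Lemma schur_iter_null K e m n u : psd_kernel K -> (m < n)%N ->
  schur_iter K e n (e m) u = 0.
Proof.
move=> psdK; elim: n u => //= n IHn u.
rewrite ltnS leq_eqVlt => /predU1P[->|mn].
  exact/schur_complement_pivot/psd_schur_iter.
by apply: schur_complement_null => v; exact: IHn.
Qed.

(** Gram-Schmidt orthogonalisation along an enumeration [e] of [X], phrased
    with kernels: the residual kernel after [n] steps vanishes at the first [n]
    points, so each point gets finitely many non-zero coordinates. *)
Theorem gram_vectors K (e : nat -> X) : (forall x, exists n, e n = x) ->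
  psd_kernel K ->
  exists c : X -> nat -> R, forall u, exists N, forall n, (N <= n)%N ->
    c u n = 0 /\ forall v, \sum_(j < n) c u j * c v j = K u v.
Proof.
move=> e_surj psdK; pose k := schur_iter K e.
exists (fun u j => k j u (e j) / Num.sqrt (k j (e j) (e j))).
move=> u; have [N <-] := e_surj u; exists N.+1 => n Nn; split.
  by rewrite /k schur_iter_null// mul0r.
move=> v; suff gram m w : \sum_(j < m)
    (k j w (e j) / Num.sqrt (k j (e j) (e j))) *
    (k j v (e j) / Num.sqrt (k j (e j) (e j))) = K w v - k m w v.
  by rewrite gram /k schur_iter_null// subr0.
elim: m => [|m IHm]; first by rewrite big_ord0 subrr.
rewrite big_ord_recr/= IHm /k/= -/k /schur_complement -/k.
have psdk : psd_kernel (k m) by exact: psd_schur_iter.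
rewrite mulrACA -invfM -expr2 sqr_sqrtr ?psd_kernel_ge0//.
by rewrite -/(k m) (psdk.1 v); ring.
Qed.

End Kernels.

(** * The Hilbert space of square-summable sequences *)

Section SquareSummable.
Context {R : realType}.

Definition square_summable (a : nat -> R) : Prop :=
  exists M : R, forall n, \sum_(j < n) a j ^+ 2 <= M.

Definition square_summable_pred : {pred nat -> R^o} :=
  fun a => `[< square_summable a >].

Lemma square_summable_submod : submod_closed square_summable_pred.
Proof.
split.
  apply/asboolP; exists 0 => n; apply: sumr_le0 => j _.
  by rewrite /= expr0n.
move=> t a b /asboolP[M aM] /asboolP[N bN]; apply/asboolP.
exists (2 * t ^+ 2 * M + 2 * N) => n.
apply: le_trans (_ : \sum_(j < n)
    (2 * t ^+ 2 * (a j : R) ^+ 2 + 2 * (b j : R) ^+ 2) <= _).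
  apply: ler_sum => j _ /=.
  have -> : (t *: a + b) j = t * a j + b j by [].
  have := sqr_ge0 (t * a j - b j).
  by rewrite !expr2; lra.
have t2 : 0 <= 2 * t ^+ 2 by rewrite mulr_ge0// sqr_ge0.
by rewrite big_split/= -!mulr_sumr lerD// ler_wpM2l// ?aM ?bN.
Qed.

HB.instance Definition _ :=
  GRing.isSubmodClosed.Build R (nat -> R^o) square_summable_pred
    square_summable_submod.

Record ell2 := Ell2 {
  ell2_seq :> nat -> R^o;
  ell2_seqP : ell2_seq \in square_summable_pred }.

HB.instance Definition _ := [isSub for ell2_seq].
HB.instance Definition _ := gen_eqMixin ell2.
HB.instance Definition _ := gen_choiceMixin ell2.
HB.instance Definition _ := [SubChoice_isSubLmodule of ell2 by <:].


Implicit Types x y z : ell2.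


Definition partial_dot (x y : nat -> R) n : R := \sum_(j < n) x j * y j.

Definition ell2_dot x y : R := limn (partial_dot x y).

Lemma nondecreasing_partial_dot x : nondecreasing_seq (partial_dot x x).
Proof.
apply/nondecreasing_seqP => n; rewrite /partial_dot big_ord_recr/= lerDl.
by rewrite -expr2 sqr_ge0.
Qed.

Lemma is_cvg_partial_dot_diag x : cvgn (partial_dot x x).
Proof.
apply: nondecreasing_is_cvgn; first exact: nondecreasing_partial_dot.
have /asboolP[M xM] := ell2_seqP x.
by exists M => _ [n _ <-]; exact: xM.
Qed.

Lemma is_cvg_partial_dot x y : cvgn (partial_dot x y).
Proof.
have -> : partial_dot x y = fun n =>
    2^-1 * (partial_dot (x + y) (x + y) n - partial_dot x x n
            - partial_dot y y n).
  apply/funext => n; rewrite /partial_dot -!sumrB mulr_sumr.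
  apply: eq_bigr => j _.
  by rewrite (_ : (x + y) j = x j + y j :> R)//; field.
apply/cvg_ex; eexists; apply: cvgMl_tmp; apply: cvgB.
  by apply: cvgB; exact: is_cvg_partial_dot_diag.
exact: is_cvg_partial_dot_diag.
Qed.

Lemma partial_dot_le x n : partial_dot x x n <= ell2_dot x x.
Proof.
apply: nondecreasing_cvgn_le; first exact: nondecreasing_partial_dot.
exact: is_cvg_partial_dot_diag.
Qed.

Lemma ell2_dot_le x (M : R) :
  (forall n, partial_dot x x n <= M) -> ell2_dot x x <= M.
Proof.
move=> xM; apply: limr_le; first exact: is_cvg_partial_dot.
exact: nearW.
Qed.

Lemma ell2_dotC x y : ell2_dot x y = ell2_dot y x.
Proof.
rewrite /ell2_dot; congr (lim (_ @ \oo)); apply/funext => n.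
by apply: eq_bigr => j _; rewrite mulrC.
Qed.

Lemma ell2_dot_linearl t x y z :
  ell2_dot (t *: x + y) z = t * ell2_dot x z + ell2_dot y z.
Proof.
apply: cvg_lim => //.
have -> : partial_dot (t *: x + y) z =
    fun n => t * partial_dot x z n + partial_dot y z n.
  apply/funext => n; rewrite /partial_dot mulr_sumr -big_split/=.
  apply: eq_bigr => j _.
  by rewrite -[LHS]/((t * x j + y j) * z j) mulrDl mulrA.
apply: cvgD; last exact: is_cvg_partial_dot.
by apply: cvgMl_tmp; exact: is_cvg_partial_dot.
Qed.

Lemma ell2_dot_ge0 x : 0 <= ell2_dot x x.
Proof. by have := partial_dot_le x 0; rewrite /partial_dot big_ord0. Qed.

Lemma ell2_dot_eq0 x : ell2_dot x x = 0 -> x = 0.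
Proof.
move=> xx0; apply/val_inj/funext => j /=.
have := partial_dot_le x j.+1; rewrite xx0 /partial_dot big_ord_recr/=.
have : 0 <= \sum_(i < j) x i * x i.
  by apply: sumr_ge0 => i _; rewrite -expr2 sqr_ge0.
have := sqr_ge0 (x j); rewrite -expr2 => ? ? ?.
by apply/eqP; rewrite -sqrf_eq0; apply/eqP; lra.
Qed.

Lemma ell2_dot_linearr x : linear_for *%R (ell2_dot x).
Proof.
by move=> t y z; rewrite /= ell2_dotC ell2_dot_linearl !(ell2_dotC x).
Qed.

Lemma ell2_dot_bilinear :
  bilinear_for *%R (@idfun R \; *%R) ell2_dot.
Proof.
split=> [y t x x'|x]; first exact: ell2_dot_linearl.
exact: ell2_dot_linearr.
Qed.

HB.instance Definition _ := bilinear_isBilinear.Build R ell2 ell2 R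
  *%R (@idfun R \; *%R) ell2_dot ell2_dot_bilinear.

Lemma ell2_dot_symmetric x y :
  ell2_dot x y = (-1) ^+ false * @idfun R (ell2_dot y x).
Proof. by rewrite expr0 mul1r ell2_dotC. Qed.

HB.instance Definition _ := isHermitianSesquilinear.Build R ell2 false
  (@idfun R) ell2_dot ell2_dot_symmetric.

Lemma ell2_dot_gt0 x : x != 0 -> 0 < ell2_dot x x.
Proof.
move=> x0; rewrite lt_neqAle ell2_dot_ge0 andbT eq_sym.
by apply: contra x0 => /eqP/ell2_dot_eq0 ->.
Qed.

HB.instance Definition _ := isDotProduct.Build R ell2 ell2_dot ell2_dot_gt0.

Lemma ell2_dotZl t x y : ell2_dot (t *: x) y = t * ell2_dot x y.
Proof. by rewrite linearZl_LR. Qed.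

Lemma ell2_dotZr t x y : ell2_dot x (t *: y) = t * ell2_dot x y.
Proof. by rewrite linearZr_LR. Qed.

Definition ell2_norm x : R := Num.sqrt (ell2_dot x x).

Lemma ell2_norm_sqr x : ell2_norm x ^+ 2 = ell2_dot x x.
Proof. by rewrite sqr_sqrtr// ell2_dot_ge0. Qed.

Lemma ell2_dotD x y :
  ell2_dot (x + y) (x + y) = ell2_dot x x + 2 * ell2_dot x y + ell2_dot y y.
Proof.
by rewrite linearDl/= !linearDr/= (ell2_dotC y x); ring.
Qed.

Lemma ell2_cauchy_schwarz x y : ell2_dot x y <= ell2_norm x * ell2_norm y.
Proof.
have : 0 <= ell2_norm x by exact: sqrtr_ge0.
rewrite le_eqVlt => /predU1P[/esym x0|x0].
  have -> : x = 0 by apply: ell2_dot_eq0; rewrite -ell2_norm_sqr x0 expr0n.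
  by rewrite linear0l mulr_ge0// sqrtr_ge0.
have : 0 <= ell2_norm y by exact: sqrtr_ge0.
rewrite le_eqVlt => /predU1P[/esym y0|y0].
  have -> : y = 0 by apply: ell2_dot_eq0; rewrite -ell2_norm_sqr y0 expr0n.
  by rewrite linear0r mulr_ge0// sqrtr_ge0.
have := ell2_dot_ge0 (ell2_norm y *: x + - ell2_norm x *: y).
rewrite ell2_dotD !ell2_dotZl !ell2_dotZr -!ell2_norm_sqr.
set p := ell2_norm x in x0 *; set q := ell2_norm y in y0 *.
rewrite (_ : _ + _ = 2 * (p * q) * (p * q - ell2_dot x y)); last by ring.
by rewrite pmulr_rge0 ?mulr_gt0// subr_ge0.
Qed.

Lemma ell2_norm_triangle x y : ell2_norm (x + y) <= ell2_norm x + ell2_norm y.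
Proof.
rewrite -ler_sqr ?nnegrE ?addr_ge0 ?sqrtr_ge0//.
rewrite ell2_norm_sqr ell2_dotD sqrrD !ell2_norm_sqr lerD2r lerD2l.
by rewrite -[leRHS]mulr_natl ler_wpM2l// ell2_cauchy_schwarz.
Qed.

Lemma ell2_normZ t x : ell2_norm (t *: x) = `|t| * ell2_norm x.
Proof.
rewrite /ell2_norm ell2_dotZl ell2_dotZr mulrA -expr2.
by rewrite sqrtrM ?sqr_ge0// sqrtr_sqr.
Qed.

Lemma ell2_norm_eq0 x : ell2_norm x = 0 -> x = 0.
Proof.
by move=> x0; apply: ell2_dot_eq0; rewrite -ell2_norm_sqr x0 expr0n.
Qed.

HB.instance Definition _ := Lmodule_isNormed.Build R ell2
  ell2_norm_triangle ell2_normZ ell2_norm_eq0.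

Lemma ell2_normE x : `|x| = ell2_norm x. Proof. by []. Qed.

Lemma ell2_coord_le x j : `|x j : R| <= `|x|.
Proof.
rewrite -ler_sqr ?nnegrE// ell2_normE ell2_norm_sqr.
apply: le_trans (partial_dot_le x j.+1).
rewrite /partial_dot big_ord_recr/= -normrX ger0_norm ?sqr_ge0// expr2 lerDr.
by apply: sumr_ge0 => i _; rewrite -expr2 sqr_ge0.
Qed.

(** Coordinatewise limits exist by completeness of the reals, and every bound
    on a partial sum of squares passes to the limit. *)
Lemma ell2_complete (F : set_system ell2) :
  ProperFilter F -> cauchy F -> cvg F.
Proof.
move=> FF /cauchy_ballP Fc.
have coord_cvg j : cvg ((fun x => x j : R) @ F).
  apply: cauchy_cvg; apply/cauchy_ballP => e e0; near_simpl.
  have := Fc e e0; apply: filterS => -[x y] /=.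
  rewrite -!ball_normE /ball_/=; apply: le_lt_trans.
  exact: ell2_coord_le (x - y) j.
pose a j : R := lim ((fun x => x j : R) @ F).
have center e : 0 < e -> exists x, F (ball x e).
  by move=> e0; have /cauchy_ballP/cauchyP := Fc; exact.
have bound e x : 0 < e -> F (ball x e) ->
    forall n, partial_dot (a - (x : nat -> R)) (a - (x : nat -> R)) n <= e ^+ 2.
  move=> e0 Fx n.
  have lim_n : partial_dot (y - x : ell2) (y - x : ell2) n @[y --> F] -->
      partial_dot (a - (x : nat -> R)) (a - (x : nat -> R)) n.
    rewrite /partial_dot; elim: n => [|n IHn].
      rewrite big_ord0; under eq_cvg do rewrite big_ord0.
      exact: cvg_cst.
    rewrite big_ord_recr/=; under eq_cvg do rewrite big_ord_recr/=.
    have cn : ((y - x : ell2) n : R) @[y --> F] --> (a n - x n : R).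
      by apply: cvgB; [exact: coord_cvg|exact: cvg_cst].
    by apply: cvgD IHn _; exact: cvgM.
  rewrite -(cvg_lim _ lim_n)//; apply: limr_le; first exact/cvgP/lim_n.
  apply: filterS Fx => y; rewrite -ball_normE /ball_/= distrC => yx.
  apply: (le_trans (partial_dot_le (y - x) n)).
  rewrite -ell2_norm_sqr -ell2_normE.
  by rewrite ler_sqr ?nnegrE// ltW.
have [x1 Fx1] := center 1 ltr01.
have d1P : (a - (x1 : nat -> R) : nat -> R^o) \in square_summable_pred.
  by apply/asboolP; exists (1 ^+ 2) => n; exact: (bound _ _ ltr01 Fx1).
pose l : ell2 := Ell2 d1P + x1.
have lE j : (l j : R) = a j by rewrite -[LHS]/(a j - x1 j + x1 j) subrK.
apply/cvg_ex; exists l; apply/cvgrPdist_le => e e0.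
have e2 : 0 < e / 2 by rewrite divr_gt0.
have [x Fx] := center _ e2.
have lx : `|l - x| <= e / 2.
  rewrite -ler_sqr ?nnegrE ?(ltW e2)// ell2_normE ell2_norm_sqr.
  apply: ell2_dot_le => n; apply: le_trans (bound _ _ e2 Fx n).
  rewrite le_eqVlt; apply/orP; left; apply/eqP/eq_bigr => j _.
  by rewrite -[(l - x) j]/((l j : R) - x j) lE.
apply: filterS Fx => y; rewrite -ball_normE /ball_/= => xy.
rewrite -(subrK x l) -addrA (le_trans (ler_normD _ _))//.
by rewrite (splitr e) lerD// ltW.
Qed.

HB.instance Definition _ := Uniform_isComplete.Build ell2 ell2_complete.

End SquareSummable.

(** * Graph distance and countability *)

Lemma countable_injection (X : Type) :
  countable [set: X] -> exists i : X -> nat, injective i.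
Proof.
by move=> /pcard_injP[i inj_i]; exists i => x y; apply: inj_i; rewrite inE.
Qed.

Lemma injection_surjection (X : Type) (x0 : X) (i : X -> nat) : injective i ->
  exists e : nat -> X, forall x, exists n, e n = x.
Proof.
move=> inj_i.
exists (fun n => if pselect (exists x, i x = n) is left ex then projT1 (cid ex)
                 else x0).
move=> x; exists (i x); case: pselect => [ex|[]]; last by exists x.
exact/inj_i/(projT2 (cid ex)).
Qed.

Section GraphDistance.
Context {V : Type} (G : graph V).

Lemma is_path_cat u v w s t :
  is_path G u v s -> is_path G v w t -> is_path G u w (s ++ t).
Proof.
by move=> [pus <-] [pvt <-]; split; rewrite ?cat_path ?pus// last_cat.
Qed.

Hypothesis connG : graph_connected G.

Lemma gdist_is_path u v : exists2 s, is_path G u v s & size s = gdist G u v.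
Proof.
have : exists n, `[< exists2 s, is_path G u v s & size s = n >].
  by have [s us] := connG u v; exists (size s); apply/asboolP; exists s.
case/ex_minnP => n /asboolP[s us sn] n_min.
rewrite /gdist; case: xgetP => [m -> [] //|/(_ n) []].
split; [by exists s|move=> t ut].
by apply: n_min; apply/asboolP; exists t.
Qed.

Lemma gdist_le_size u v s : is_path G u v s -> (gdist G u v <= size s)%N.
Proof.
rewrite /gdist => us; case: xgetP => [m _ [_]|_]//.
exact.
Qed.

Lemma gdist_adj u v : adj G u v -> (gdist G u v <= 1)%N.
Proof.
by move=> uv; apply: (@gdist_le_size _ _ [:: v]); split; rewrite //= uv.
Qed.

Lemma finite_neighbours u : locally_finite G -> finite_set [set v | adj G u v].
Proof.
move=> /(_ u) fin_u.
apply: (@sub_finite_set _ _ (\bigcup_(e in [set e | edges G e /\ e u]) e)).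
  move=> v /set_mem uv; exists [set u; v]; last by right.
  by split=> //; left.
apply: bigcup_finite => // e [Ge _].
have [a [b ->]] := edges_pair Ge.
exact: finite_set2.
Qed.

(** A connected graph is the union of its spheres around a vertex, which are
    finite by local finiteness. *)
Lemma vertices_countable : locally_finite G -> countable [set: V].
Proof.
move=> lfG; have [[v0 _]|noV] := pselect (exists v : V, True); last first.
  by rewrite (_ : [set: V] = set0)// -subset0 => v _; case: noV; exists v.
pose sphere n := [set v | exists2 s, is_path G v0 v s & size s = n].
rewrite (_ : [set: V] = \bigcup_n sphere n); last first.
  apply/esym; rewrite -subTset => v _; have [s os] := connG v0 v.
  by exists (size s) => //; exists s.
apply: bigcup_countable => // n _; apply: finite_set_countable.
elim: n => [|n IHn].
  apply: (sub_finite_set _ (finite_set1 v0)) => v [s [_ <-]] /size0nil -> //.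
apply: (@sub_finite_set _ _ (\bigcup_(u in sphere n) [set v | adj G u v])).
  move=> v [s]; case/lastP: s => // s w [].
  rewrite rcons_path last_rcons => /andP[os ow] <-; rewrite size_rcons => -[sn].
  by exists (last v0 s) => //; exists s.
by apply: bigcup_finite => // u _; exact: finite_neighbours.
Qed.

End GraphDistance.

(** * Measures from finitely additive set functions on clopen sets *)

(** A copy of [T] carrying the algebra of clopen sets, on which a finitely
    additive set function is fed to the extension of measures. *)
Definition clopen_algebra (T : Type) := T.

Section ClopenAlgebra.
Context {T : ptopologicalType}.

HB.instance Definition _ := Pointed.on (clopen_algebra T).
HB.instance Definition _ := isAlgebraOfSets.Build default_measure_display
  (clopen_algebra T) (@clopen0 T) (@clopenU T) (fun A => @clopenC T A A).

End ClopenAlgebra.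

Section ClopenContent.
Context {R : realType} {T : ptopologicalType} (mu : set T -> R).
Hypothesis compactT : compact [set: T].
Hypothesis mu_ge0 : forall A, 0 <= mu A.
Hypothesis muT : mu [set: T] = 1.
Hypothesis muU : forall A B, clopen A -> clopen B -> A `&` B = set0 ->
  mu (A `|` B) = mu A + mu B.

Let mu0 : mu set0 = 0.
Proof.
have := muU (@clopen0 T) (@clopen0 T) (setI0 _).
by rewrite setU0 => /eqP; rewrite addrC -subr_eq subrr eq_sym => /eqP.
Qed.

Let content (A : set (clopen_algebra T)) : \bar R := (mu A)%:E.

Let content_ge0 A : (0 <= content A)%E.
Proof. by rewrite lee_fin. Qed.

(** By compactness a clopen set is never an infinite disjoint union of
    non-empty clopen sets, so additivity suffices. *)
Let content_sigma_additive : semi_sigma_additive content.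
Proof.
move=> F clF trivF clU.
have [N Nempty] : exists N, forall n, (N <= n)%N -> F n = set0.
  have /(_ nat [set: nat] F) : cover_compact (\bigcup_n F n).
    rewrite -compact_cover; apply: subclosed_compact compactT _ => //.
    by have [] := clU.
  case=> [n _|//|D _ UD]; first by have [] := clF n.
  exists (\max_(i <- finmap.enum_fset D) i).+1%N => n Dn.
  rewrite -subset0 => x Fnx.
  have [|i /= iD Fix] := UD x; first by exists n.
  have ni : i = n by apply: (trivF i n) => //; exists x.
  by move: Dn; rewrite -ni ltnNge (@leq_bigmax_seq _ _ xpredT id i iD).
have -> : content (\bigcup_n F n) = (\sum_(0 <= i < N) content (F i))%E.
  have -> : \bigcup_n F n = \big[setU/set0]_(i < N) F i.
    rewrite -bigcup_mkord; apply/seteqP; split=> [x [n _ Fnx]|x [n _ Fnx]].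
      exists n => //=; rewrite ltnNge; apply/negP => /Nempty Fn0.
      by rewrite Fn0 in Fnx.
    by exists n.
  rewrite big_mkord /content sumEFin; congr (_%:E).
  elim: N {Nempty} => [|n IHn]; first by rewrite !big_ord0.
  rewrite !big_ord_recr/= muU ?IHn//.
  - by elim/big_ind : _ => [|A B clA clB|i _];
      [exact: clopen0|exact: clopenU|exact: clF].
  - exact: clF.
  - rewrite -bigcup_mkord -subset0 => x [[i /= ni Fix] Fnx].
    have /eqP := trivF i n I I (ex_intro _ x (conj Fix Fnx)).
    by rewrite ltn_eqF.
apply: cvg_near_cst; exists N => // n /= Nn.
rewrite (@big_cat_nat _ _ _ N)//= [X in (_ + X)%E]big1_seq ?adde0//.
move=> i /andP[_]; rewrite mem_index_iota => /andP[Ni _].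
by rewrite /content Nempty// mu0.
Qed.

HB.instance Definition _ := isMeasure.Build _ (clopen_algebra T) R content
  (congr1 EFin mu0) content_ge0 content_sigma_additive.

Hypothesis open_clopen : forall A : set T, open A ->
  exists2 F : nat -> set T, (forall n, clopen (F n)) & A = \bigcup_n F n.

Let clopen_type := g_sigma_algebraType (@measurable _ (clopen_algebra T)).
Let borel_type := g_sigma_algebraType (@open T).

Let extension : set clopen_type -> \bar R := measure_extension content.

HB.instance Definition _ := Measure.on extension.

Let extension_clopen A : clopen A -> extension A = (mu A)%:E.
Proof. by move=> clA; exact: (measurable_mu_extE content). Qed.

Let extension_setT : extension [set: clopen_type] = 1%E.
Proof. by rewrite extension_clopen ?muT//; exact: clopenT. Qed.

HB.instance Definition _ :=
  Measure_isProbability.Build _ _ _ extension extension_setT.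

Let to_borel (x : clopen_type) : borel_type := x.

Let measurable_to_borel : measurable_fun [set: clopen_type] to_borel.
Proof.
apply: (@measurability _ _ clopen_type borel_type setT to_borel (@open T) erefl)
  => _ [B oB <-].
have [F clF ->] := open_clopen oB; rewrite setTI preimage_bigcup.
by apply: bigcup_measurable => n _; apply: sub_sigma_algebra; exact: clF.
Qed.

HB.instance Definition _ :=
  isMeasurableFun.Build _ _ _ _ to_borel measurable_to_borel.

(** The extension lives on the sigma-algebra generated by the clopen sets, which
    contains the open sets as these are countable unions of clopen ones. *)
Theorem clopen_content_extension :
  exists P : probability borel_type R, forall A, clopen A -> P A = (mu A)%:E.
Proof. by exists (distribution extension to_borel) => A /extension_clopen. Qed.

End ClopenContent.

(** * The space of percolation configurations *)

Section ConfigurationSpace.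
Context {V : Type} (G : graph V).
Implicit Types w : cfg_space G.

Lemma cfg_space_compact : compact [set: cfg_space G].
Proof.
have := @tychonoff _ (fun _ : edges G => bool) _ (fun=> bool_compact).
by congr (compact _); rewrite eqEsubset.
Qed.

Lemma clopen_edge_state (e : edges G) (b : bool) :
  clopen [set w : cfg_space G | w e = b].
Proof.
apply: (@preimage_clopen _ _ (fun w : cfg_space G => w e) [set b]).
  by split; [exact: discrete_open|exact: discrete_closed].
exact: (@proj_continuous _ (fun _ => bool) e).
Qed.

Lemma clopen_open_edge (e : edges G) : clopen [set w : cfg_space G | w e].
Proof. exact: clopen_edge_state e true. Qed.

(** The numbering [i] of the edges makes finite bit strings index a
    countable base of the topology. *)
Definition cylinder (i : edges G -> nat) (bs : seq bool) : set (cfg_space G) :=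
  [set w | forall e, (i e < size bs)%N -> w e = nth false bs (i e)].

Lemma clopen_cylinder i bs : injective i -> clopen (cylinder i bs).
Proof.
move=> inj_i.
suff clopen_prefix n : clopen [set w : cfg_space G |
    forall e, (i e < n)%N -> w e = nth false bs (i e)] by exact: clopen_prefix.
elim: n => [|n IHn].
  by rewrite (_ : [set _ | _] = setT); [exact: clopenT|exact/seteqP].
pose here := [set w : cfg_space G | forall e, i e = n -> w e = nth false bs n].
have clopen_here : clopen here.
  have [[e ie]|no_e] := pselect (exists e, i e = n).
    rewrite (_ : here = [set w : cfg_space G | w e = nth false bs n]).
      exact: clopen_edge_state.
    apply/seteqP; split=> w /= we; first exact: we.
    by move=> e' e'n; rewrite (inj_i e' e) ?e'n.
  rewrite (_ : here = setT); first exact: clopenT.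
  by apply/seteqP; split=> // w _ e ie; case: no_e; exists e.
rewrite (_ : [set _ | _] = [set w : cfg_space G |
    forall e, (i e < n)%N -> w e = nth false bs (i e)] `&` here).
  exact: clopenI.
apply/seteqP; split=> w /= => [wE|[wE here_w] e].
  split=> e ie; first by apply: wE; rewrite ltnW.
  by rewrite wE ie.
rewrite ltnS leq_eqVlt => /predU1P[ie|]; last exact: wE.
by rewrite ie here_w.
Qed.

Lemma open_bigcup_cylinder (i : edges G -> nat) (A : set (cfg_space G)) :
  injective i -> open A ->
  exists2 F : nat -> set (cfg_space G),
    (forall n, clopen (F n)) & A = \bigcup_n F n.
Proof.
move=> inj_i oA.
have base w : A w ->
    exists2 bs : seq bool, cylinder i bs w & cylinder i bs `<=` A.
  move=> Aw.
  pose agree n := [set w' : cfg_space G |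
    forall e, (i e < n)%N -> w' e = w e].
  pose F := filter_from [set: nat] agree.
  have FF : Filter F.
    apply: filter_from_filter; first by exists 0%N.
    move=> m n _ _; exists (maxn m n) => // w' w'E.
    by split=> e em; apply: w'E; rewrite (leq_trans em)// ?leq_maxl ?leq_maxr.
  (* Only coordinatewise convergence of F has to be checked. *)
  have Fw : F --> w.
    apply/cvg_sup => e; apply/cvg_image => [|B /nbhs_singleton Bwe].
      by apply/seteqP; split=> // b _; exists (fun=> b).
    exists [set w' | B (w' e)].
      by exists (i e).+1 => // w' /(_ e (leqnn _)) /= ->.
    by apply/seteqP; split=> [_ [w' Bw' <-] //|b Bb]; exists (fun=> b).
  have [n _ sub] : F A by apply/Fw/open_nbhs_nbhs.
  pose bs := mkseq (fun k => `[< exists2 e, i e = k & w e >]) n.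
  have bsE e : (i e < n)%N -> w e = nth false bs (i e).
    move=> en; rewrite nth_mkseq//; apply/idP/asboolP; first by exists e.
    by case=> e' /inj_i ->.
  exists bs => [e|w' w'bs]; first by rewrite size_mkseq; exact: bsE.
  by apply: sub => e en; rewrite w'bs ?size_mkseq// bsE.
pose F n : set (cfg_space G) :=
  if unpickle n is Some bs then
    if pselect (cylinder i bs `<=` A) is left _ then cylinder i bs else set0
  else set0.
exists F => [n|].
  rewrite /F; case: unpickle => [bs|]; last exact: clopen0.
  by case: pselect => _; [exact: clopen_cylinder|exact: clopen0].
apply/seteqP; split=> [w /base[bs bsw bsA]|w [n _]].
  by exists (pickle bs) => //; rewrite /F pickleK; case: pselect.
by rewrite /F; case: unpickle => // bs; case: pselect => // bsA; exact: bsA.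
Qed.

Lemma clopen_adj u v :
  clopen [set w : cfg_space G | adj (open_subgraph w) u v].
Proof.
have [Guv|nGuv] := boolP ([set u; v] \in edges G).
  rewrite (_ : [set _ | _] = [set w : cfg_space G | w (SigSub Guv)]).
    exact: clopen_open_edge.
  apply/seteqP; split=> w => [/set_mem[e we eE]|wuv].
    by rewrite (_ : SigSub Guv = e); [exact: we|exact: val_inj].
  by apply/mem_set; exists (SigSub Guv).
rewrite (_ : [set _ | _] = set0); first exact: clopen0.
rewrite -subset0 => w /set_mem[e _ eE]; move: nGuv.
by rewrite -eE (valP e).
Qed.

Definition path_event u v s : set (configuration G) :=
  [set w | is_path (open_subgraph w) u v s].

Lemma clopen_path_event u v s :
  @clopen (cfg_space G) (path_event u v s).
Proof.
rewrite /path_event /is_path.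
elim: s u => [|x s IHs] u /=.
  have [<-|uv] := pselect (u = v).
    by rewrite (_ : [set _ | _] = setT); [exact: clopenT|exact/seteqP].
  rewrite (_ : [set _ | _] = set0); first exact: clopen0.
  by rewrite -subset0 => w [_ /uv].
rewrite (_ : [set _ | _] = [set w : cfg_space G | adj (open_subgraph w) u x]
  `&` path_event x v s).
  by apply: clopenI; [exact: clopen_adj|exact: IHs].
by apply/seteqP; split=> w /=; rewrite /path_event /is_path /=;
  [move=> [/andP[]]|move=> [-> []]].
Qed.

Lemma measurable_path_event u v s : measurable (path_event u v s).
Proof. by apply: sub_sigma_algebra; have [] := clopen_path_event u v s. Qed.

Lemma same_cluster_bigcup u v (e : nat -> seq V) :
  (forall s, exists n, e n = s) ->
  [set w : configuration G | same_cluster w u v] =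
  \bigcup_n path_event u v (e n).
Proof.
move=> e_surj; apply/seteqP; split=> w /= => [[s ws]|[n _ wn]].
  by have [n en] := e_surj s; exists n => //; rewrite en.
by exists (e n).
Qed.

Lemma same_cluster_refl (w : configuration G) u : same_cluster w u u.
Proof. by exists [::]. Qed.

Lemma same_cluster_trans (w : configuration G) u v x :
  same_cluster w u v -> same_cluster w v x -> same_cluster w u x.
Proof. by move=> [s us] [t vt]; exists (s ++ t); exact: is_path_cat us vt. Qed.

Lemma same_cluster_sym (w : configuration G) u v :
  same_cluster w u v -> same_cluster w v u.
Proof.
move=> [s [ws <-]]; elim: s u ws => [|x s IHs] u /=.
  by move=> _; exact: same_cluster_refl.
move=> /andP[ux xs]; apply: same_cluster_trans (IHs _ xs) _.
by exists [:: u]; split=> //=; rewrite andbT /adj setUC.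
Qed.

Lemma edges_countable : countable [set: V] -> countable [set: edges G].
Proof.
move=> /countable_injection[i inj_i]; apply/countable_injP.
have ends (e : edges G) : exists p : V * V, val e = [set p.1; p.2].
  have [u [v uv]] := edges_pair (set_mem (valP e)).
  by exists (u, v).
pose end_pair e := projT1 (cid (ends e)).
exists (fun e => pickle (i (end_pair e).1, i (end_pair e).2)).
move=> e e' _ _ /(pcan_inj pickleK)[/inj_i e1 /inj_i e2].
apply: val_inj; rewrite (projT2 (cid (ends e))) (projT2 (cid (ends e'))).
by rewrite -/(end_pair e) -/(end_pair e') e1 e2.
Qed.

End ConfigurationSpace.

Lemma seq_countable (X : Type) : countable [set: X] -> countable [set: seq X].
Proof.
move=> /countable_injection[i inj_i]; apply/countable_injP.
exists (fun s => pickle (map i s)) => s t _ _ /(pcan_inj pickleK).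
exact: inj_map.
Qed.

(** * Limits of finitely additive probabilities *)

Section UltrafilterLimit.
Context {R : realType}.

Lemma ultra_cvg_bounded (U : set_system nat) (a : nat -> R) (M : R) :
  UltraFilter U -> (forall n, 0 <= a n <= M) -> cvg (a n @[n --> U]).
Proof.
move=> uU aM.
have [|p [_ pU]] := @segment_compact R 0 M (a n @[n --> U]) _.
  by apply: nearW => n; rewrite /= in_itv/= aM.
apply/cvg_ex; exists p => B Bp.
have [//|UnB] := in_ultra_setVsetC (a @^-1` B) uU.
by have [x []] := pU (~` B) B UnB Bp.
Qed.

Context {T : Type} (nu : nat -> set T -> R).
Hypothesis nu_ge0 : forall n A, 0 <= nu n A.
Hypothesis nuT : forall n, nu n [set: T] = 1.
Hypothesis nuU : forall n A B, A `&` B = set0 ->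
  nu n (A `|` B) = nu n A + nu n B.

Let nu_le1 n A : nu n A <= 1.
Proof.
by rewrite -(nuT n) -(setUv A) nuU ?setICr// lerDl nu_ge0.
Qed.

(** An ultrafilter picks a limit for the values of all events at once, and
    limits along it preserve sums. *)
Lemma finitely_additive_limit : exists mu : set T -> R,
  [/\ forall A, 0 <= mu A, mu [set: T] = 1,
      forall A B, A `&` B = set0 -> mu (A `|` B) = mu A + mu B &
      forall A (a : R), ((\forall n \near \oo, a <= nu n A) -> a <= mu A) /\
        ((\forall n \near \oo, nu n A <= a) -> mu A <= a)].
Proof.
have [U [uU ooU]] := @ultraFilterLemma nat \oo _.
have nu_cvg A : cvg (nu n A @[n --> U]).
  by apply: (@ultra_cvg_bounded _ _ 1 uU) => n; rewrite nu_ge0 nu_le1.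
exists (fun A => lim (nu n A @[n --> U])); split=> [A||A B AB|A a].
- by apply: limr_ge => //; exact: nearW.
- by apply: cvg_lim => //; under eq_cvg do rewrite nuT; exact: cvg_cst.
- apply: cvg_lim => //; under eq_cvg do rewrite nuU//.
  by apply: cvgD; exact: nu_cvg.
- split=> /ooU nuA; first exact: limr_ge.
  exact: limr_le.
Qed.

End UltrafilterLimit.

(** Compactness of the configuration space turns any sequence of finitely
    additive random configurations into a genuine percolation whose clopen
    events inherit the asymptotic bounds. *)
Theorem percolation_limit (R : realType) (V : Type) (G : graph V)
    (nu : nat -> set (configuration G) -> R) :
  countable [set: V] ->
  (forall n A, 0 <= nu n A) -> (forall n, nu n setT = 1) ->
  (forall n A B, A `&` B = set0 -> nu n (A `|` B) = nu n A + nu n B) ->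
  exists P : probability (configuration G) R,
    forall A (a : R), @clopen (cfg_space G) A ->
    ((\forall n \near \oo, a <= nu n A) -> (a%:E <= P A)%E) /\
    ((\forall n \near \oo, nu n A <= a) -> (P A <= a%:E)%E).
Proof.
move=> /(@edges_countable _ G)/countable_injection[i inj_i].
move=> nu_ge0 nuT nuU.
have [mu [mu_ge0 muT muU mu_lim]] := finitely_additive_limit nu_ge0 nuT nuU.
pose T : ptopologicalType := HB.pack (cfg_space G)
  (Pointed.on (cfg_space G)) (Topological.on (cfg_space G)).
have [P PE] := @clopen_content_extension R T mu
  (@cfg_space_compact _ G) mu_ge0 muT (fun A B _ _ => @muU A B)
  (fun A => @open_bigcup_cylinder _ G i A inj_i).
exists P => A a clA; have [lea gea] := mu_lim A a.
by rewrite PE// !lee_fin.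
Qed.

(** * Percolation from random cuts *)

Section RandomCuts.
Context {R : realType} {X : Type}.
Implicit Types (l : seq (R * (X -> bool))) (K : seq (X -> bool)).

(** The expectation of [F K], where [K] contains each cut [c.2] of [l]
    independently with probability [1 - c.1]. *)
Fixpoint cut_mean l (F : seq (X -> bool) -> R) : R :=
  if l is c :: l' then
    c.1 * cut_mean l' F + (1 - c.1) * cut_mean l' (fun K => F (c.2 :: K))
  else F [::].

Definition uncut K u v : bool := all (fun S => S u == S v) K.

Definition uncut_prob l u v : R :=
  \prod_(c <- l) (if c.2 u == c.2 v then 1 else c.1).

Definition is_prob_list l : Prop := forall c, List.In c l -> 0 <= c.1 <= 1.

Lemma cut_mean_le l F F' : is_prob_list l -> (forall K, F K <= F' K) ->
  cut_mean l F <= cut_mean l F'.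
Proof.
elim: l F F' => [|c l IHl] F F' l01 FF' //=.
have /andP[c0 c1] := l01 c (or_introl erefl).
have l01' : is_prob_list l by move=> d dl; apply: l01; right.
by rewrite lerD// ler_wpM2l ?subr_ge0//; exact: IHl.
Qed.

Lemma cut_mean_cst l a : cut_mean l (fun=> a) = a.
Proof. by elim: l => //= c l ->; ring. Qed.

Lemma cut_meanD l F F' :
  cut_mean l (fun K => F K + F' K) = cut_mean l F + cut_mean l F'.
Proof. by elim: l F F' => //= c l IHl F F'; rewrite !IHl; ring. Qed.

(** Each cut separating [u] from [v] has to be omitted, independently of the
    others. *)
Lemma cut_mean_uncut l u v :
  cut_mean l (fun K => (uncut K u v)%:R) = uncut_prob l u v.
Proof.
rewrite /uncut_prob; elim: l => [|c l IHl] /=; first by rewrite big_nil.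
rewrite big_cons IHl; case: ifP => cuv; first by rewrite IHl; ring.
by rewrite cut_mean_cst mulr0 addr0.
Qed.

End RandomCuts.

Section CutPercolation.
Context {R : realType} {V : Type} (G : graph V).
Implicit Types (K : seq (V -> bool)).

Definition cut_configuration K : configuration G := fun e =>
  all (fun S => `[< forall u v, val e u -> val e v -> S u = S v >]) K.

Lemma cut_configuration_edge K (e : edges G) u v :
  val e = [set u; v] -> cut_configuration K e = uncut K u v.
Proof.
move=> eE; apply: eq_all => S; rewrite eE; apply/asboolP/eqP => [|Suv x y].
  by apply; [left|right].
by move=> [] -> [] ->.
Qed.

Lemma uncut_trans K u v x : uncut K u v -> uncut K v x -> uncut K u x.
Proof.
rewrite /uncut; elim: K => //= S K IHK /andP[/eqP-> /IHK uv].
by move=> /andP[-> /uv].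
Qed.

Lemma uncut_cluster K u v :
  same_cluster (cut_configuration K) u v -> uncut K u v.
Proof.
move=> [s [Ks <-]]; elim: s u Ks => [|x s IHs] u /=.
  by move=> _; apply/allP.
move=> /andP[/set_mem[e Ke eE] xs]; apply: uncut_trans (IHs _ xs).
by rewrite -(cut_configuration_edge K eE).
Qed.

(** All edges crossing a chosen cut are closed, so connected vertices lie
    on the same side of all chosen cuts. The connection event is open, and is
    exhausted by the clopen events of being joined by one of finitely many
    paths. *)
Theorem cut_percolation (l : nat -> seq (R * (V -> bool))) :
  countable [set: V] -> (forall n, is_prob_list (l n)) ->
  exists P : probability (configuration G) R,
    (forall (e : edges G) u v (a : R), val e = [set u; v] ->
       (\forall n \near \oo, a <= uncut_prob (l n) u v) ->
       (a%:E <= P [set w : configuration G | w e])%E) /\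
    (forall u v (a : R), (\forall n \near \oo, uncut_prob (l n) u v <= a) ->
       two_point P u v <= a).
Proof.
move=> cntV l01.
pose nu n (A : set (configuration G)) : R :=
  cut_mean (l n) (fun K => \1_A (cut_configuration K)).
have [||n A B AB|P PE] := @percolation_limit R V G nu cntV.
- move=> n A; rewrite -(cut_mean_cst (l n) 0); exact: cut_mean_le.
- by move=> n; rewrite -(cut_mean_cst (l n) 1); congr cut_mean;
    apply/funext => K; rewrite indicT.
- rewrite /nu -cut_meanD; congr cut_mean; apply/funext => K.
  set w := cut_configuration K; rewrite !indicE in_setU.
  have [wA|_] := boolP (w \in A); last by rewrite add0r.
  have [wB|_] := boolP (w \in B); last by rewrite addr0.
  suff : (A `&` B) w by rewrite AB.
  by split; exact: set_mem.
exists P; split=> [e u v a eE nua|u v a nua].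
  apply: (PE _ a (clopen_open_edge e)).1; apply: filterS nua => n.
  rewrite -cut_mean_uncut => /le_trans; apply; apply: cut_mean_le => // K.
  by rewrite indicE -(cut_configuration_edge K eE) mem_setE.
have [i inj_i] := countable_injection (seq_countable cntV).
have [paths paths_surj] := injection_surjection [::] inj_i.
pose B N : set (configuration G) := \bigcup_(k < N) path_event u v (paths k).
have clopenB N : @clopen (cfg_space G) (B N).
  rewrite /B bigcup_mkord; elim/big_ind: _ => [|C D clC clD|k _].
  - exact: clopen0.
  - exact: clopenU.
  - exact: clopen_path_event.
have measurableB N : measurable (B N).
  by apply: sub_sigma_algebra; have [] := clopenB N.
have unionB : [set w : configuration G | same_cluster w u v] = \bigcup_N B N.
  rewrite (same_cluster_bigcup G u v paths_surj).
  apply/seteqP; split=> w [k _]; first by exists k.+1 => //; exists k => /=.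
  by case=> j _ wj; exists j.
have leB N : (P (B N) <= a%:E)%E.
  apply: (PE _ a (clopenB N)).2; apply: filterS nua => n; apply: le_trans.
  rewrite -cut_mean_uncut; apply: cut_mean_le => // K.
  rewrite indicE; case: (boolP (_ \in _)) => [/set_mem[k _ Kk]|_]; last first.
    by rewrite mulr0n ler0n.
  by rewrite (uncut_cluster (u := u) (v := v))//; exists (paths k).
have measurableU : measurable (\bigcup_N B N) by exact: bigcup_measurable.
rewrite /two_point unionB -lee_fin fineK ?fin_num_measure//.
have cvgB : P (B N) @[N --> \oo] --> P (\bigcup_N B N).
  apply: nondecreasing_cvg_mu => // m n mn; apply/subsetPset => w [k /= km wk].
  by exists k => //=; exact: leq_trans km mn.
rewrite -(cvg_lim _ cvgB)//; apply: lime_le; first exact/cvgP/cvgB.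
exact: nearW.
Qed.

End CutPercolation.

(** * Random signs and thresholds *)

Section SignedSums.
Context {R : realType} {V : Type} (c : V -> nat -> R).

(** A uniformly chosen entry [g] of this list is a Rademacher sum: its increment
    [g u - g v] is the sum of the [c u j - c v j] with independent random signs.
    The recursive form gives the moments by induction on [n]. *)
Fixpoint signed_sums n : seq (V -> R) :=
  if n is m.+1 then
    [seq (fun u => g u + c u m) | g <- signed_sums m] ++
    [seq (fun u => g u - c u m) | g <- signed_sums m]
  else [:: fun=> 0].

Lemma big_signed_sumsS n (F : (V -> R) -> R) :
  \sum_(g <- signed_sums n.+1) F g =
  \sum_(g <- signed_sums n)
    (F (fun u => g u + c u n) + F (fun u => g u - c u n)).
Proof. by rewrite big_cat/= !big_map big_split. Qed.

Lemma size_signed_sums n : size (signed_sums n) = (2 ^ n)%N.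
Proof.
by elim: n => //= n IHn; rewrite size_cat !size_map IHn expnS mul2n addnn.
Qed.

Lemma sum_signed_sums_cst n (a : R) :
  \sum_(g <- signed_sums n) a = 2 ^+ n * a.
Proof.
by rewrite big_const_seq count_predT size_signed_sums iter_addr_0
  -[LHS]mulr_natl natrX.
Qed.

Definition sqdist n u v : R := \sum_(j < n) (c u j - c v j) ^+ 2.

Lemma signed_sums_second_moment n u v :
  \sum_(g <- signed_sums n) (g u - g v) ^+ 2 = 2 ^+ n * sqdist n u v.
Proof.
rewrite /sqdist; elim: n => [|n IHn].
  by rewrite big_ord0 big_seq1 subrr expr0n mulr0.
rewrite big_signed_sumsS big_ord_recr/= mulrDr exprS -!mulrA -IHn.
rewrite mulr_sumr -(sum_signed_sums_cst n ((c u n - c v n) ^+ 2)) mulr_sumr.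
by rewrite -big_split; apply: eq_bigr => g _ /=; ring.
Qed.

(** Adding one more random sign [+/- d] turns [x ^ 4] into
    [x ^ 4 + 6 x ^ 2 d ^ 2 + d ^ 4] on average, and the cross term is exactly
    the one in [3 (sqdist + d ^ 2) ^ 2]. *)
Lemma signed_sums_fourth_moment n u v :
  \sum_(g <- signed_sums n) (g u - g v) ^+ 4 <=
  2 ^+ n * (3 * sqdist n u v ^+ 2).
Proof.
elim: n => [|n IHn].
  by rewrite /sqdist big_ord0 big_seq1 subrr !expr0n !mulr0.
pose d := c u n - c v n.
rewrite big_signed_sumsS (_ : \sum_(g <- _) _ =
  2 * \sum_(g <- signed_sums n) (g u - g v) ^+ 4 +
  12 * d ^+ 2 * \sum_(g <- signed_sums n) (g u - g v) ^+ 2 +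
  2 * \sum_(g <- signed_sums n) d ^+ 4); last first.
  rewrite !mulr_sumr -!big_split; apply: eq_bigr => g _ /=.
  by rewrite /d; ring.
rewrite signed_sums_second_moment sum_signed_sums_cst.
rewrite {2}/sqdist big_ord_recr/= -/(sqdist n u v) -/d (exprS 2 n).
have d4 : 0 <= 2 ^+ n * d ^+ 4.
  by apply: mulr_ge0; [exact: exprn_ge0|exact: exprn_even_ge0].
rewrite -subr_ge0.
rewrite (_ : _ - _ = 2 * (2 ^+ n * (3 * sqdist n u v ^+ 2) -
  \sum_(g <- signed_sums n) (g u - g v) ^+ 4) + 4 * (2 ^+ n * d ^+ 4));
  last by ring.
by rewrite addr_ge0// mulr_ge0// subr_ge0.
Qed.

(** Khinchine: [8 z >= 6 z ^ 2 - z ^ 4 / 2] for [z >= 0], as the difference is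
    [z (z - 2) ^ 2 (z + 4) / 2]; taking [z = |g u - g v| / r] bounds the first
    moment below by the second and fourth. *)
Lemma signed_sums_first_moment_ge n u v (r : R) : 0 <= r ->
  sqdist n u v = r ^+ 2 ->
  2 ^+ n * (9 / 16 * r) <= \sum_(g <- signed_sums n) `|g u - g v|.
Proof.
rewrite le_eqVlt => /predU1P[<- _|r0 dr].
  by rewrite !mulr0; apply: sumr_ge0.
apply: (@le_trans _ _ (\sum_(g <- signed_sums n)
    (3 / 4 / r * (g u - g v) ^+ 2 - (16 * r ^+ 3)^-1 * (g u - g v) ^+ 4))).
  rewrite sumrB -!mulr_sumr signed_sums_second_moment dr.
  have := signed_sums_fourth_moment n u v; rewrite dr => m4.
  have r3 : 0 < (16 * r ^+ 3)^-1 by rewrite invr_gt0 mulr_gt0// exprn_gt0.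
  apply: le_trans (lerB (lexx _) (ler_wpM2l (ltW r3) m4)).
  rewrite le_eqVlt; apply/orP; left; apply/eqP; field.
  by rewrite gt_eqF.
apply: ler_sum => g _; set x := g u - g v.
have -> : x ^+ 2 = `|x| ^+ 2 by rewrite real_normK// num_real.
have -> : x ^+ 4 = `|x| ^+ 4 by rewrite -normrX ger0_norm// exprn_even_ge0.
set y := `|x|; have y0 : 0 <= y by rewrite normr_ge0.
rewrite -subr_ge0 (_ : _ - _ =
  (16 * r ^+ 3)^-1 * (y * (y - 2 * r) ^+ 2 * (y + 4 * r))).
  apply: mulr_ge0; first by rewrite invr_ge0 mulr_ge0// exprn_ge0// ltW.
  apply: mulr_ge0; first by apply: mulr_ge0 => //; exact: sqr_ge0.
  by apply: addr_ge0 => //; apply: mulr_ge0 => //; exact: ltW.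
by field; rewrite gt_eqF.
Qed.

Lemma signed_sums_first_moment_le n u v :
  \sum_(g <- signed_sums n) `|g u - g v| <=
  2 ^+ n * ((1 + sqdist n u v) / 2).
Proof.
apply: (@le_trans _ _ (\sum_(g <- signed_sums n)
    (1 / 2 + 1 / 2 * (g u - g v) ^+ 2))).
  apply: ler_sum => g _; set x := g u - g v.
  have -> : x ^+ 2 = `|x| ^+ 2 by rewrite real_normK// num_real.
  by have := sqr_ge0 (`|x| - 1); rewrite sqrrB1 expr2; lra.
rewrite big_split/= sum_signed_sums_cst -mulr_sumr signed_sums_second_moment.
by rewrite le_eqVlt; apply/orP; left; apply/eqP; field.
Qed.

Lemma signed_sums_bounded n g u : List.In g (signed_sums n) ->
  `|g u| <= \sum_(j < n) `|c u j|.
Proof.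
elim: n g => [|n IHn] g /=.
  by case=> // <-; rewrite big_ord0 normr0.
rewrite big_ord_recr/= List.in_app_iff !List.in_map_iff.
move=> [] [h [<- /IHn hu]]; rewrite (le_trans (ler_normD _ _))// ?normrN;
  by rewrite lerD.
Qed.

End SignedSums.

Section Thresholds.
Context {R : realType}.

Lemma count_below m (z : R) : 0 <= z <= m%:R ->
  z <= \sum_(0 <= i < m) ((i%:R < z)%R%:R : R) <= z + 1.
Proof.
move=> /andP[z0 zm].
suff [H1 H2] :
  (z <= m%:R -> z <= \sum_(0 <= i < m) ((i%:R < z)%R%:R : R) <= z + 1) /\
  (m%:R <= z -> \sum_(0 <= i < m) ((i%:R < z)%R%:R : R) = m%:R) by exact: H1.
elim: m {zm} => [|m [IH1 IH2]].
  by rewrite big_geq//; split=> // z_le0; apply/andP; split=> //; lra.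
rewrite big_nat_recr//=; have [mz|zm] := ltP m%:R z.
  rewrite (IH2 (ltW mz)) -natr1; split=> // zm.
  by apply/andP; split=> //; rewrite lerD2r ltW.
rewrite mulr0n addr0; split=> [_|]; first exact: IH1.
by rewrite -natr1 => ?; exfalso; lra.
Qed.

(** Whether [x] exceeds the threshold [i / t - t]; for [i < 2 t ^ 2] these
    thresholds sweep [[-t, t)] with spacing [1 / t]. *)
Definition above (t i : nat) (x : R) : bool := (i%:R < x * t%:R + t%:R ^+ 2).

(** A threshold separates [x] from [y] when it is below exactly one of them, and
    the number of thresholds below a point is known up to 1. *)
Lemma count_separating (t : nat) (x y : R) : `|x| <= t%:R -> `|y| <= t%:R ->
  let N := \sum_(0 <= i < 2 * t ^ 2) ((above t i x != above t i y)%:R : R) in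
  t%:R * `|x - y| - 1 <= N <= t%:R * `|x - y| + 1.
Proof.
wlog yx : x y / y <= x => [wlogH xt yt|xt yt].
  have /orP[yx|xy] := le_total y x; first exact: wlogH.
  have := wlogH _ _ xy yt xt; rewrite distrC.
  by under eq_bigr do rewrite eq_sym.
have mt : (2 * t ^ 2)%:R = 2 * t%:R ^+ 2 :> R by rewrite natrM natrX.
have in_range (z : R) : `|z| <= t%:R ->
    0 <= z * t%:R + t%:R ^+ 2 <= (2 * t ^ 2)%:R.
  rewrite ler_norml mt => /andP[z1 z2]; have t0 := ler0n R t.
  by apply/andP; split; nra.
have /andP[x1 x2] := count_below (in_range _ xt).
have /andP[y1 y2] := count_below (in_range _ yt).
have -> : \sum_(0 <= i < 2 * t ^ 2) ((above t i x != above t i y)%:R : R) =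
    \sum_(0 <= i < 2 * t ^ 2) ((above t i x)%:R : R) -
    \sum_(0 <= i < 2 * t ^ 2) ((above t i y)%:R : R).
  rewrite -sumrB; apply: eq_bigr => i _.
  have : above t i y -> above t i x.
    move=> /lt_le_trans; apply; rewrite lerD2r ler_wpM2r//.
  case: (above t i y); case: (above t i x) => yx'; rewrite /= ?subrr ?subr0//.
  by have := yx' isT.
rewrite ger0_norm ?subr_ge0// /above.
set Nx := \sum_(0 <= i < _) _ in x1 x2 *.
set Ny := \sum_(0 <= i < _) _ in y1 y2 *.
by apply/andP; split; lra.
Qed.

End Thresholds.

Lemma ler_sum_In (R : realType) (I : Type) (s : seq I) (F F' : I -> R) :
  (forall x, List.In x s -> F x <= F' x) ->
  \sum_(x <- s) F x <= \sum_(x <- s) F' x.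
Proof.
elim: s => [|x s IHs] FF'; first by rewrite !big_nil.
rewrite !big_cons lerD//; first by apply: FF'; left.
by apply: IHs => y sy; apply: FF'; right.
Qed.

Section ThresholdCuts.
Context {R : realType} {V : Type} (c : V -> nat -> R).
Hypothesis c_finite : forall u, exists N, forall n, (N <= n)%N -> c u n = 0.
Context (lambda : R).
Hypothesis lambda_ge0 : 0 <= lambda.

Definition threshold_cuts t n : seq (V -> bool) :=
  [seq (fun u => above t i (g u)) | g <- signed_sums c n,
                                    i <- index_iota 0 (2 * t ^ 2)].

(** Each cut is omitted with probability [exp (- a)]. The rate
    [a = lambda / (t 2 ^ n)], where [t = n + 1], makes [a] times the number
    of cuts separating [u] from [v] close to [lambda] times the average of
    [|g u - g v|]. *)
Definition poisson_cuts n : seq (R * (V -> bool)) :=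
  [seq (expR (- (lambda / (n.+1%:R * 2 ^+ n))), C)
     | C <- threshold_cuts n.+1 n].

Lemma poisson_cuts_is_prob n : is_prob_list (poisson_cuts n).
Proof.
move=> d /List.in_map_iff[C [<- _]] /=.
rewrite expR_ge0 -expR0 ler_expR oppr_le0.
by rewrite divr_ge0// mulr_ge0// exprn_ge0.
Qed.

Lemma uncut_prob_exp (a : R) (s : seq (V -> bool)) u v :
  uncut_prob [seq (expR (- a), C) | C <- s] u v =
  expR (- (a * \sum_(C <- s) (C u != C v)%:R)).
Proof.
rewrite /uncut_prob big_map; elim: s => [|C s IHs].
  by rewrite !big_nil mulr0 oppr0 expR0.
rewrite !big_cons IHs mulrDr opprD expRD.
by case: eqP => _; rewrite /= ?mulr0 ?oppr0 ?expR0 ?mulr1.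
Qed.

Lemma sum_threshold_cuts t n u v :
  \sum_(C <- threshold_cuts t n) ((C u != C v)%:R : R) =
  \sum_(g <- signed_sums c n) \sum_(0 <= i < 2 * t ^ 2)
    ((above t i (g u) != above t i (g v))%:R : R).
Proof. by rewrite big_allpairs_dep. Qed.

(** Since [c u] has finite support, [|g u|] is bounded uniformly in [n],
    so every vertex eventually enters the range of the thresholds. *)
Lemma signed_sums_near_bounded u :
  \forall n \near \oo, forall g, List.In g (signed_sums c n) ->
    `|g u| <= n.+1%:R.
Proof.
have [N cN] := c_finite u.
have sum_le n : \sum_(j < n) `|c u j| <= \sum_(j < N) `|c u j|.
  have -> : \sum_(j < N) `|c u j| = \sum_(j < N + n) `|c u j|.
    elim: n => [|n IHn]; first by rewrite addn0.
    by rewrite addnS big_ord_recr/= -IHn cN ?leq_addr// normr0 addr0.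
  by rewrite addnC big_split_ord/= lerDl; exact: sumr_ge0.
near=> n => g gn; apply: le_trans (signed_sums_bounded u gn) _.
apply: le_trans (sum_le n) _; rewrite -natr1 ler_wpDr// ltW//.
near: n; exact: nbhs_infty_gtr.
Unshelve. all: by end_near. Qed.

(** The moment bounds for signed sums control the exponent; the terms [+ 1] and
    [- 1] absorb the discretisation by thresholds. *)
Theorem uncut_prob_poisson_cuts u v (r : R) : 0 <= r ->
  (\forall n \near \oo, sqdist c n u v = r ^+ 2) ->
  \forall n \near \oo,
    expR (- (lambda * ((1 + r ^+ 2) / 2 + 1))) <=
      uncut_prob (poisson_cuts n) u v <=
    expR (- (lambda * (9 / 16 * r - 1))).
Proof.
move=> r0 dist_r; near=> n.
have dr : sqdist c n u v = r ^+ 2 by near: n.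
have boundu : forall g, List.In g (signed_sums c n) -> `|g u| <= n.+1%:R.
  by near: n; exact: signed_sums_near_bounded.
have boundv : forall g, List.In g (signed_sums c n) -> `|g v| <= n.+1%:R.
  by near: n; exact: signed_sums_near_bounded.
rewrite uncut_prob_exp !ler_expR !lerN2 sum_threshold_cuts.
set t : R := n.+1%:R; set M := \sum_(g <- _) _.
set E := \sum_(g <- signed_sums c n) `|g u - g v|.
have t1 : 1 <= t by rewrite ler1n.
have p0 : 0 < 2 ^+ n :> R by exact: exprn_gt0.
have Mle : M <= t * E + 2 ^+ n.
  rewrite mulr_sumr -[X in _ + X]mulr1 -(sum_signed_sums_cst c n) -big_split/=.
  apply: ler_sum_In => g gn.
  by have /andP[] := count_separating (boundu g gn) (boundv g gn).
have Mge : t * E - 2 ^+ n <= M.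
  rewrite mulr_sumr -[X in _ - X]mulr1 -(sum_signed_sums_cst c n) -sumrB.
  apply: ler_sum_In => g gn.
  by have /andP[] := count_separating (boundu g gn) (boundv g gn).
have Ele : E <= 2 ^+ n * ((1 + r ^+ 2) / 2).
  by rewrite -dr; exact: signed_sums_first_moment_le.
have Ege : 2 ^+ n * (9 / 16 * r) <= E by exact: signed_sums_first_moment_ge.
have tp : 0 < t * 2 ^+ n by rewrite mulr_gt0// (lt_le_trans ltr01).
have t0 : 0 <= t by exact: le_trans t1.
have ptp : 2 ^+ n <= t * 2 ^+ n by rewrite ler_peMl// ltW.
have tEle := ler_wpM2l t0 Ele; have tEge := ler_wpM2l t0 Ege.
apply/andP; split; rewrite -(mulrA lambda) ler_wpM2l//.
  rewrite mulrC ler_pdivrMr//; apply: le_trans Mle _.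
  by rewrite mulrDl mul1r lerD// [leRHS]mulrC -mulrA.
rewrite [leRHS]mulrC ler_pdivlMr//; apply: le_trans Mge.
by rewrite mulrBl mul1r lerB// [leLHS]mulrC -(mulrA t).
Unshelve. all: by end_near. Qed.



End ThresholdCuts.

(** * The two-point function as a kernel *)

(** The form at [s] is the sum, over the values [z] of [k], of the squared total
    weight of the points of [s] sent to [z]. *)
Lemma psd_eq_kernel (R : realType) (X : Type) (T : eqType) (k : X -> T) :
  psd_kernel (fun u v => (k u == k v)%:R : R).
Proof.
split=> [u v|s]; first by rewrite eq_sym.
pose t := [seq (x.1, k x.2) | x <- s]; pose r := undup [seq x.2 | x <- t].
have -> : quad_form (fun u v => (k u == k v)%:R) s =
    \sum_(x <- t) \sum_(y <- t) x.1 * y.1 * (x.2 == y.2)%:R.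
  by rewrite big_map; apply: eq_bigr => x _; rewrite big_map.
have split_eq (x y : R * T) : x \in t -> (x.2 == y.2)%:R =
    \sum_(z <- r) (x.2 == z)%:R * (y.2 == z)%:R :> R.
  move=> tx; rewrite (bigD1_seq x.2) ?undup_uniq//=; last first.
    by rewrite mem_undup map_f.
  rewrite eqxx mul1r eq_sym big1 ?addr0// => z.
  by rewrite eq_sym => /negPf ->; rewrite mul0r.
suff -> : \sum_(x <- t) \sum_(y <- t) x.1 * y.1 * (x.2 == y.2)%:R =
    \sum_(z <- r) (\sum_(x <- t) x.1 * (x.2 == z)%:R) ^+ 2.
  by apply: sumr_ge0 => z _; exact: sqr_ge0.
under [RHS]eq_bigr do rewrite expr2 big_distrlr/=.
rewrite [RHS]exchange_big/=; apply: eq_big_seq => x tx.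
rewrite [RHS]exchange_big/=; apply: eq_bigr => y _.
by rewrite split_eq// mulr_sumr; apply: eq_bigr => z _; ring.
Qed.

Section TwoPoint.
Context {R : realType} {V : Type} {G : graph V}.
Hypothesis cntV : countable [set: V].
Context (P : probability (configuration G) R).

Lemma measurable_same_cluster u v :
  measurable [set w : configuration G | same_cluster w u v].
Proof.
have [i inj_i] := countable_injection (seq_countable cntV).
have [e e_surj] := injection_surjection [::] inj_i.
rewrite (same_cluster_bigcup G u v e_surj).
by apply: bigcup_measurable => n _; exact: measurable_path_event.
Qed.

Lemma two_point_sum (s : seq (R * (V * V))) :
  let F w := \sum_(x <- s)
    x.1 * \1_[set w : configuration G | same_cluster w x.2.1 x.2.2] w in
  P.-integrable setT (EFin \o F) /\
  (\int[P]_w F w = \sum_(x <- s) x.1 * two_point P x.2.1 x.2.2)%R.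
Proof.
elim: s => [|x s [int_s IHs]] /=.
  under [X in _.-integrable _ X]eq_fun do rewrite big_nil.
  split; first exact: finite_measure_integrable_cst.
  rewrite big_nil; under eq_Rintegral do rewrite big_nil.
  by rewrite Rintegral_cst// mul0r.
set A := [set w : configuration G | same_cluster w x.2.1 x.2.2].
have mA : measurable A by exact: measurable_same_cluster.
have int_A : P.-integrable setT (EFin \o \1_A) by exact: integrable_indic.
have int_x : P.-integrable setT (EFin \o (fun w => x.1 * \1_A w)).
  by have := integrableZl measurableT x.1 int_A; apply: eq_integrable.
split.
  apply: eq_integrable (integrableD measurableT int_x int_s) => // w _.
  by rewrite /= big_cons EFinD.
under eq_Rintegral do rewrite big_cons.
rewrite RintegralD// big_cons IHs RintegralZl//; congr (_ * _ + _).
by rewrite /Rintegral integral_indic// setIT.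
Qed.

(** Being in the same cluster is an equivalence relation for each configuration,
    so the form is the expectation of a non-negative random variable. *)
Lemma psd_two_point : psd_kernel (two_point P).
Proof.
split=> [u v|s].
  rewrite /two_point; congr (fine (P _)).
  by apply/seteqP; split=> w; exact: same_cluster_sym.
pose s2 := [seq (x.1 * y.1, (x.2, y.2)) | x <- s, y <- s].
have -> : quad_form (two_point P) s =
    \sum_(x <- s2) x.1 * two_point P x.2.1 x.2.2 by rewrite big_allpairs_dep.
rewrite -(two_point_sum s2).2; apply: Rintegral_ge0 => w _.
rewrite big_allpairs_dep/=.
have [_ /(_ s)] := psd_eq_kernel R (fun u => [set v | same_cluster w u v]).
congr (_ <= _); apply: eq_bigr => x _; apply: eq_bigr => y _; congr (_ * _%:R).
rewrite [RHS]/=; congr nat_of_bool; apply/eqP/idP => [xy|/set_mem/= xy].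
  apply/mem_set => /=.
  have : [set v | same_cluster w y.2 v] y.2 by exact: same_cluster_refl.
  by rewrite -xy.
apply/seteqP; split=> v /= => xv; last exact: same_cluster_trans xv.
by apply: same_cluster_trans xv; exact: same_cluster_sym.
Qed.

Lemma two_point_ge0 u v : 0 <= two_point P u v.
Proof. exact: fine_ge0. Qed.

Lemma two_point_le1 u v : two_point P u v <= 1.
Proof.
rewrite -lee_fin fineK; last first.
  by rewrite fin_num_measure//; exact: measurable_same_cluster.
by apply: probability_le1; exact: measurable_same_cluster.
Qed.

Lemma two_point_refl u : two_point P u u = 1.
Proof.
rewrite /two_point (_ : [set _ | _] = setT) ?probability_setT//.
by apply/seteqP; split=> // w _; exact: same_cluster_refl.
Qed.

Lemma two_point_compl u v : (1 - two_point P u v)%:E =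
  P (~` [set w : configuration G | same_cluster w u v]).
Proof.
have muv := measurable_same_cluster u v.
by rewrite probability_setC// EFinB fineK// fin_num_measure.
Qed.

Lemma two_point_triangle u v x :
  1 - two_point P u x <= (1 - two_point P u v) + (1 - two_point P v x).
Proof.
have muv := measurable_same_cluster u v.
have mvx := measurable_same_cluster v x.
have mux := measurable_same_cluster u x.
rewrite -lee_fin [leRHS]EFinD !two_point_compl.
apply: le_trans (measureU2 _ (measurableC muv) (measurableC mvx)).
apply: le_measure; rewrite ?inE.
- exact: measurableC.
- by apply: measurableU; exact: measurableC.
- rewrite -setCI; apply: subsetC => w [uv vx]; exact: same_cluster_trans vx.
Qed.

Lemma two_point_adj (p : R) (e : edges G) u v : val e = [set u; v] ->
  (p%:E <= P [set w : configuration G | w e])%E -> p <= two_point P u v.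
Proof.
move=> eE pe; rewrite -lee_fin fineK; last first.
  by rewrite fin_num_measure//; exact: measurable_same_cluster.
apply: le_trans pe _; apply: le_measure; rewrite ?inE.
- by apply: sub_sigma_algebra; have [] := clopen_open_edge e.
- exact: measurable_same_cluster.
- move=> w we; exists [:: v]; split=> //=; rewrite andbT.
  by apply/mem_set; exists e.
Qed.

(** If [u] and [v] are disconnected then some edge of a geodesic is closed. *)
Lemma two_point_gdist (p : R) u v : graph_connected G ->
  (forall e : edges G, (p%:E <= P [set w : configuration G | w e])%E) ->
  1 - two_point P u v <= (1 - p) * (gdist G u v)%:R.
Proof.
move=> connG pe; have [s [us <-] <-] := gdist_is_path connG u v.
elim: s u us => [|x s IHs] u /=; first by rewrite two_point_refl subrr mulr0.
move=> /andP[ux /IHs xs]; apply: le_trans (two_point_triangle u x _) _.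
rewrite -natr1 mulrDr mulr1 addrC lerD// lerB//.
exact: (@two_point_adj p (SigSub ux)).
Qed.

End TwoPoint.

(** * Realising kernels in Hilbert space *)

Lemma cvg_sum_seq (R : realType) (I : Type) (s : seq I) (a : nat -> I -> R)
    (b : I -> R) : (forall i, a n i @[n --> \oo] --> b i) ->
  \sum_(i <- s) a n i @[n --> \oo] --> \sum_(i <- s) b i.
Proof.
move=> ab; elim: s => [|i s IHs].
  by rewrite big_nil; under eq_cvg do rewrite big_nil; exact: cvg_cst.
by rewrite big_cons; under eq_cvg do rewrite big_cons; exact: cvgD.
Qed.

Section Realisation.
Context {R : realType} {X : Type}.

Lemma gram_sqdist (K : X -> X -> R) : countable [set: X] -> psd_kernel K ->
  exists c : X -> nat -> R,
    (forall u, exists N, forall n, (N <= n)%N -> c u n = 0) /\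
    forall u v, \forall n \near \oo,
      sqdist c n u v = K u u + K v v - 2 * K u v.
Proof.
move=> cntX psdK; have [[x0 _]|noX] := pselect (exists x : X, True); last first.
  by exists (fun _ _ => 0); split=> u; case: noX; exists u.
have [i inj_i] := countable_injection cntX.
have [e e_surj] := injection_surjection x0 inj_i.
have [c cP] := gram_vectors e_surj psdK; exists c; split=> [u|u v].
  by have [N cN] := cP u; exists N => n /cN[].
have [Nu cu] := cP u; have [Nv cv] := cP v.
exists (maxn Nu Nv) => // n /=; rewrite geq_max => /andP[/cu[_ cuE] /cv[_ cvE]].
rewrite -(cuE u) -(cvE v) -(cuE v) mulr_sumr -big_split -sumrB.
by apply: eq_bigr => j _ /=; ring.
Qed.

Lemma psd_realisation (K : X -> X -> R) : countable [set: X] -> psd_kernel K ->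
  exists f : X -> @ell2 R, forall u v,
    `|f u - f v| ^+ 2 = K u u + K v v - 2 * K u v.
Proof.
move=> cntX psdK; have [c [c_finite c_dist]] := gram_sqdist cntX psdK.
have c_ell2 u : (c u : nat -> R^o) \in square_summable_pred.
  have [N cN] := c_finite u; apply/asboolP.
  exists (\sum_(j < N) c u j ^+ 2) => n.
  have -> : \sum_(j < N) c u j ^+ 2 = \sum_(j < N + n) c u j ^+ 2.
    elim: n => [|n IHn]; first by rewrite addn0.
    by rewrite addnS big_ord_recr/= -IHn cN ?leq_addr// expr0n addr0.
  rewrite addnC big_split_ord/= lerDl; apply: sumr_ge0 => j _.
  exact: sqr_ge0.
exists (fun u => Ell2 (c_ell2 u)) => u v.
rewrite ell2_normE ell2_norm_sqr; apply: cvg_lim => //.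
by apply: cvg_near_cst; apply: filterS (c_dist u v).
Qed.

(** Recentring at a base point: the new form at [s] is the old one at [s]
    completed by a point of weight opposite to the total weight of [s]. *)
Lemma psd_recentre (K : X -> X -> R) p : psd_kernel K ->
  psd_kernel (fun u v => K u v - K u p - K p v + K p p).
Proof.
move=> [symK psdK]; split=> [u v|s].
  by rewrite symK (symK u p) (symK p v); ring.
have := psdK ((- \sum_(x <- s) x.1, p) :: s); rewrite quad_form_cons//.
congr (_ <= _); rewrite /quad_form sqrrN expr2.
rewrite [RHS](_ : _ = \sum_(x <- s) \sum_(y <- s)
    (x.1 * y.1 * K x.2 y.2 - x.1 * K x.2 p * y.1 -
     x.1 * (y.1 * K y.2 p) + x.1 * y.1 * K p p)); last first.
  apply: eq_bigr => x _; apply: eq_bigr => y _.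
  by rewrite (symK p); ring.
under [RHS]eq_bigr do
  rewrite big_split/= !sumrB -!mulr_sumr -mulr_suml -mulr_sumr.
rewrite big_split/= !sumrB -!mulr_suml.
ring.
Qed.

Lemma psd_sum (k : nat -> X -> X -> R) N : (forall n, psd_kernel (k n)) ->
  psd_kernel (fun u v => \sum_(n < N) k n u v).
Proof.
move=> psdk; split=> [u v|s].
  by apply: eq_bigr => n _; exact: (psdk n).1.
rewrite /quad_form; under eq_bigr do under eq_bigr do rewrite mulr_sumr.
under eq_bigr do rewrite exchange_big/=.
rewrite exchange_big/=; apply: sumr_ge0 => n _.
exact: (psdk n).2.
Qed.

Lemma psd_lim (k : nat -> X -> X -> R) (K : X -> X -> R) :
  (forall n, psd_kernel (k n)) ->
  (forall u v, k n u v @[n --> \oo] --> K u v) -> psd_kernel K.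
Proof.
move=> psdk kK; split=> [u v|s].
  rewrite -(cvg_lim _ (kK v u))//; apply/esym/cvg_lim => //.
  apply: cvg_trans (kK u v); apply: near_eq_cvg; apply: nearW => n.
  exact: (psdk n).1.
have cvg_quad : quad_form (k n) s @[n --> \oo] --> quad_form K s.
  apply: cvg_sum_seq => x; apply: cvg_sum_seq => y.
  by apply: cvgMl_tmp; exact: kK.
rewrite -(cvg_lim _ cvg_quad)//; apply: limr_ge; first exact/cvgP/cvg_quad.
by apply: nearW => n; exact: (psdk n).2.
Qed.

End Realisation.

(** * From percolations to an embedding *)

(** The lower control function at [t] is the infimum of the image distances
    of points at distance at least [t]. Adding [[t, oo)] to the competitors
    keeps the infimum meaningful, and divergent, when no such points exist. *)
Lemma coarse_embedding_of_large (R : realType) (X Y : Type) (dX : X -> X -> R)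
    (dY : Y -> Y -> R) (f : X -> Y) (rho2 : R -> R) :
  (forall u v, 0 <= dX u v) -> (forall x y, 0 <= dY x y) ->
  control_function rho2 -> (forall u v, dY (f u) (f v) <= rho2 (dX u v)) ->
  (forall M, exists r, forall u v, r <= dX u v -> M <= dY (f u) (f v)) ->
  coarse_embedding dX dY f.
Proof.
move=> dX0 dY0 ctl2 le2 large.
pose far t := [set s : R | t <= s \/
  exists u v, t <= dX u v /\ s = dY (f u) (f v)].
have far0 t : 0 <= t -> lbound (far t) 0.
  by move=> t0 s [/(le_trans t0)//|[u [v [_ ->]]]].
have far_nonempty t : far t !=set0 by exists t; left.
have far_inf t s : 0 <= t -> far t s -> inf (far t) <= s.
  by move=> t0 ts; apply: ge_inf => //; exists 0; exact: far0.
exists (fun t => inf (far t)), rho2; split=> //.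
- split=> [t t0|s t s0 st]; first by apply: lb_le_inf => //; exact: far0.
  apply: lb_le_inf => // x [tx|[u [v [tuv ->]]]]; apply: far_inf => //.
    by left; exact: le_trans tx.
  by right; exists u, v; split=> //; exact: le_trans tuv.
- apply/cvgryPge => M; have [r rP] := large M.
  near=> t; apply: lb_le_inf => // x [tx|[u [v [tuv ->]]]].
    apply: le_trans tx; near: t; apply: nbhs_pinfty_ge; exact: num_real.
  apply/rP/(le_trans _ tuv); near: t; apply: nbhs_pinfty_ge; exact: num_real.
- move=> u v; rewrite le2 andbT; apply: far_inf => //.
  by right; exists u, v.
Unshelve. all: by end_near. Qed.

Lemma vanishes_at_infinityP (R : realType) (V : Type) (G : graph V)
    (tau : V -> V -> R) : (forall u v, 0 <= tau u v <= 1) ->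
  vanishes_at_infinity G tau <->
  forall e, 0 < e -> exists r : R, forall u v,
    r < (gdist G u v)%:R -> tau u v <= e.
Proof.
move=> tau01; rewrite /vanishes_at_infinity.
set far := fun r : R =>
  [set t | exists u v, r < (gdist G u v)%:R /\ t = tau u v].
have le_sup r u v : r < (gdist G u v)%:R -> tau u v <= sup (far r).
  move=> ruv; apply: ub_le_sup; last by exists u, v.
  by exists 1 => t [x [y [_ ->]]]; have /andP[] := tau01 x y.
have sup_ge0 r : 0 <= sup (far r).
  have [->|/set0P[t [u [v [ruv _]]]]] := eqVneq (far r) set0.
    by rewrite sup0.
  by apply: le_trans (le_sup _ _ _ ruv); have /andP[] := tau01 u v.
split=> [/cvgrPdist_le lim0 e e0|small].
  have [r [_ rP]] := lim0 e e0; exists (r + 1) => u v /le_sup/le_trans; apply.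
  have := rP (r + 1); rewrite ltrDl ltr01 => /(_ isT).
  by rewrite sub0r normrN ger0_norm ?sup_ge0.
apply/cvgrPdist_le => e e0; have [r0 r0P] := small e e0; near=> r.
rewrite sub0r normrN ger0_norm ?sup_ge0// -/(far r).
have [->|/set0P far_n0] := eqVneq (far r) set0; first by rewrite sup0 ltW.
apply: ge_sup => // t [u [v [ruv ->]]]; apply: r0P; apply: le_lt_trans ruv.
near: r; apply: nbhs_pinfty_ge; exact: num_real.
Unshelve. all: by end_near. Qed.

Section PercolationEmbedding.
Context {R : realType} {V : Type} (G : graph V).
Hypothesis connG : graph_connected G.
Hypothesis cntV : countable [set: V].
Context (P : nat -> probability (configuration G) R).
Hypothesis P_edge : forall n (e : edges G),
  ((1 - 2 ^- n.+1)%:E < P n [set w : configuration G | w e])%E.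
Hypothesis P_vanishes : forall n, vanishes_at_infinity G (two_point (P n)).

Let disconn n u v : R := 1 - two_point (P n) u v.

Let disconn_ge0 n u v : 0 <= disconn n u v.
Proof. by rewrite subr_ge0 two_point_le1. Qed.

Let disconn_le n u v : disconn n u v <= 2 ^- n.+1 * (gdist G u v)%:R.
Proof.
have := two_point_gdist cntV (P := P n) u v connG (fun e => ltW (P_edge n e)).
by rewrite subKr.
Qed.

Let partial u v N := \sum_(n < N) disconn n u v.

Let partial_le u v N : partial u v N <= (gdist G u v)%:R.
Proof.
have geo : \sum_(n < N) 2 ^- n.+1 = 1 - 2 ^- N :> R.
  elim: N => [|N IHN]; first by rewrite big_ord0 expr0 invr1 subrr.
  rewrite big_ord_recr/= IHN exprS; field.
  by rewrite expf_neq0.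
apply: (@le_trans _ _ (\sum_(n < N) 2 ^- n.+1 * (gdist G u v)%:R)).
  by apply: ler_sum => n _; exact: disconn_le.
rewrite -mulr_suml geo ler_piMl// lerBlDr lerDl invr_ge0 exprn_ge0//.
Qed.

(** Twice this quantity will be the square of the distance in the Hilbert
    space. *)
Let dist u v : R := limn (partial u v).

Let is_cvg_partial u v : cvgn (partial u v).
Proof.
apply: nondecreasing_is_cvgn; last first.
  by exists (gdist G u v)%:R => _ [N _ <-]; exact: partial_le.
apply/nondecreasing_seqP => N.
by rewrite /partial big_ord_recr/= lerDl disconn_ge0.
Qed.

Let dist_le u v : dist u v <= (gdist G u v)%:R.
Proof. by apply: limr_le => //; exact: nearW. Qed.

Let partial_le_dist u v N : partial u v N <= dist u v.
Proof.
apply: nondecreasing_cvgn_le => //; apply/nondecreasing_seqP => M.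
by rewrite /partial big_ord_recr/= lerDl disconn_ge0.
Qed.

(** Far enough apart, each of the first [N] disconnection probabilities is at
    least [1 / 2]. *)
Let dist_large (M : R) : exists r : R, forall u v,
  r <= (gdist G u v)%:R -> M <= dist u v.
Proof.
have [N MN] : exists N : nat, M <= N%:R / 2.
  exists (Num.truncn `|2 * M|).+1.
  have := truncnS_gt `|2 * M|; have := ler_norm (2 * M); lra.
have [r rP] : exists r : R, forall u v, r < (gdist G u v)%:R ->
    forall n, (n < N)%N -> two_point (P n) u v <= 1 / 2.
  elim: N {MN} => [|N [r rP]]; first by exists 0.
  have tau01 u v : 0 <= two_point (P N) u v <= 1.
    by rewrite two_point_ge0 two_point_le1.
  have [|r' r'P] := (vanishes_at_infinityP G tau01).1 (P_vanishes N) (1 / 2).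
    by rewrite divr_gt0.
  exists (Num.max r r') => u v; rewrite gt_max => /andP[ruv r'uv] n.
  rewrite ltnS leq_eqVlt => /predU1P[->|]; [exact: r'P|exact: rP].
exists (r + 1) => u v ruv; apply: le_trans MN _.
apply: le_trans (partial_le_dist u v N).
have -> : N%:R / 2 = \sum_(n < N) 1 / 2 :> R.
  by rewrite -mulr_suml sumr_const card_ord.
have {}ruv : r < (gdist G u v)%:R by apply: lt_le_trans ruv; rewrite ltrDl.
apply: ler_sum => n _; have := rP _ _ ruv _ (ltn_ord n).
by rewrite /disconn; lra.
Qed.

(** The kernel [dist] is conditionally negative definite: recentred at [p]
    it is a limit of sums of recentred two-point functions, hence positive
    semi-definite, and it is then realised in [ell2]. *)
Lemma percolation_embedding :
  hilbert_coarsely_embeddable (fun u v => (gdist G u v)%:R : R).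
Proof.
exists (@ell2 R), (@ell2_dot R); split=> [x|].
  by rewrite ell2_normE ell2_norm_sqr.
suff [f fE] : exists f : V -> @ell2 R,
    forall u v, `|f u - f v| ^+ 2 = 2 * dist u v.
  exists f.
  apply: (@coarse_embedding_of_large _ _ _ _ _ _ (fun t => Num.sqrt (2 * t))).
  - by move=> u v; rewrite ler0n.
  - by move=> x y; rewrite normr_ge0.
  - split=> [t _|s t s0 st]; first exact: sqrtr_ge0.
    by rewrite ler_wsqrtr// ler_pM2l.
  - move=> u v; rewrite -ler_sqr ?nnegrE ?sqrtr_ge0// fE sqr_sqrtr.
      by rewrite ler_pM2l// dist_le.
    by rewrite mulr_ge0.
  - move=> M; have [r rP] := dist_large (`|M| ^+ 2); exists r => u v /rP Muv.
    apply: le_trans (ler_norm M) _; rewrite -ler_sqr ?nnegrE// fE.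
    by have := sqr_ge0 `|M|; lra.
have [[p _]|noV] := pselect (exists p : V, True); last first.
  by exists (fun=> 0) => u; case: noV; exists u.
pose K u v := dist u p + dist p v - dist u v.
have dist_refl u : dist u u = 0.
  apply: cvg_lim => //; apply: cvg_near_cst; apply: nearW => N.
  by apply: big1 => n _; rewrite /disconn two_point_refl subrr.
have dist_sym u v : dist u v = dist v u.
  rewrite /dist; congr (lim (_ @ \oo)); apply/funext => N.
  by apply: eq_bigr => n _; rewrite /disconn (psd_two_point cntV (P n)).1.
pose k n u v := two_point (P n) u v - two_point (P n) u p
  - two_point (P n) p v + two_point (P n) p p.
have psdK : psd_kernel K.
  apply: (@psd_lim _ _ (fun N u v => \sum_(n < N) k n u v)).
    move=> N; apply: (psd_sum (k := k)) => n.
    exact: psd_recentre (psd_two_point cntV (P n)).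
  move=> u v; have cvgK : partial u p N + partial p v N - partial u v N
      @[N --> \oo] --> K u v.
    by apply: cvgB; [apply: cvgD|]; exact: is_cvg_partial.
  apply: cvg_trans cvgK; apply: near_eq_cvg; apply: nearW => N.
  rewrite -big_split -sumrB; apply: eq_bigr => n _ /=.
  by rewrite /k /disconn two_point_refl; ring.
have [f fE] := psd_realisation cntV psdK; exists f => u v.
by rewrite fE /K !dist_refl (dist_sym p v) (dist_sym p u); ring.
Qed.

End PercolationEmbedding.

(** * From an embedding to percolations *)

Lemma psd_dot (R : realType) (H : completeNormedModType R)
    (ip : {dot H for @idfun R}) (X : Type) (f : X -> H) :
  is_hilbert_product ip -> psd_kernel (fun u v => ip (f u) (f v)).
Proof.
move=> ipH; split=> [u v|s]; first by rewrite hermC expr0 mul1r.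
have ipZl t x y : ip (t *: x) y = t * ip x y by rewrite linearZl_LR.
have ipZr t x y : ip x (t *: y) = t * ip x y by rewrite linearZr_LR.
have -> : quad_form (fun u v => ip (f u) (f v)) s =
    `|\sum_(x <- s) x.1 *: f x.2| ^+ 2.
  rewrite ipH linear_sumlz; apply: eq_bigr => x _.
  rewrite linear_sumr; apply: eq_bigr => y _.
  by rewrite -mulrA -ipZr -ipZl.
exact: sqr_ge0.
Qed.

(** An edge lies on one side of all chosen cuts with probability close to 1 when
    [lambda] is small, as its ends have images at distance at most [rho2 1];
    vertices far apart are separated because their images are far apart. *)
Lemma embedding_percolation (R : realType) (V : Type) (G : graph V) (p : R) :
  graph_connected G -> countable [set: V] -> p < 1 ->
  hilbert_coarsely_embeddable (fun u v => (gdist G u v)%:R : R) ->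
  exists P : probability (configuration G) R,
    (forall e : edges G, (p%:E < P [set w : configuration G | w e])%E) /\
    vanishes_at_infinity G (two_point P).
Proof.
move=> connG cntV p1 [H [ip [ipH [f [rho1 [rho2 [ctl1 ctl2 rho1y rho12]]]]]]].
have [c [c_finite c_dist]] := gram_sqdist cntV (psd_dot f ipH).
have {}c_dist u v : \forall n \near \oo, sqdist c n u v = `|f u - f v| ^+ 2.
  apply: filterS (c_dist u v) => n ->; rewrite ipH linearBl !linearBr /=.
  by rewrite (hermC ip (f v) (f u)) /= expr0 mul1r; ring.
(* The exponent at an edge is at most lambda * C, and exp (- x) >= 1 - x then
   leaves an edge probability of at least (1 + p) / 2. *)
pose C := (1 + rho2 1 ^+ 2) / 2 + 1.
have C0 : 0 < C by rewrite /C; have := sqr_ge0 (rho2 1); lra.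
pose lambda := (1 - p) / (2 * C).
have lambda0 : 0 < lambda by rewrite divr_gt0 ?subr_gt0 ?mulr_gt0.
have [P [P_edge P_two_point]] := cut_percolation (R := R) G cntV
  (@poisson_cuts_is_prob R V c lambda (ltW lambda0)).
have uncut u v :=
  uncut_prob_poisson_cuts c_finite (ltW lambda0) (normr_ge0 _) (c_dist u v).
exists P; split=> [e|].
  have [u [v eE]] := edges_pair (set_mem (valP e)).
  apply: (@lt_le_trans _ _ (expR (- (lambda * C)))%:E).
    rewrite lte_fin; apply: lt_le_trans (expR_ge1Dx _).
    rewrite (_ : lambda * C = (1 - p) / 2); first by lra.
    by rewrite /lambda; field; rewrite gt_eqF.
  apply: (P_edge e u v) => //; apply: filterS (uncut u v) => n /andP[+ _].
  apply: le_trans; rewrite ler_expR lerN2 ler_wpM2l ?(ltW lambda0)// lerD2r.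
  rewrite ler_pM2r ?invr_gt0// lerD2l ler_sqr ?nnegrE//; last first.
    by apply: ctl2.1.
  have /andP[_ /le_trans] := rho12 u v; apply; apply: ctl2.2 => //.
  by rewrite lern1; apply: gdist_adj => //; rewrite /adj -eE; exact: valP.
apply/vanishes_at_infinityP => [u v|e e0].
  by rewrite two_point_ge0 two_point_le1.
(* The distance at which the upper bound on the two-point function equals e. *)
pose M := 16 / 9 * (1 - ln e / lambda).
have /cvgryPge/(_ M)[r [_ rP]] := rho1y.
exists r => u v ruv.
apply: P_two_point; apply: filterS (uncut u v) => n /andP[_].
move=> /le_trans; apply; rewrite -[leRHS]lnK ?posrE// ler_expR.
have Mf : M <= `|f u - f v|.
  by have /andP[+ _] := rho12 u v; apply: le_trans; exact: rP.
have -> : ln e = - (lambda * (9 / 16 * M - 1)).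
  by rewrite /M; field; rewrite gt_eqF.
by rewrite lerN2 ler_wpM2l ?(ltW lambda0)// lerD2r ler_wpM2l.
Qed.

Theorem theorem1p1 (R : realType) (V : Type) (G : graph V)
    (locfinG : locally_finite G) (connG : graph_connected G) :
  hilbert_coarsely_embeddable (fun u v => (gdist G u v)%:R : R) <->
  (forall p : R, p < 1 ->
    exists P : probability (configuration G) R,
      (forall e : edges G, (p%:E < P [set w : configuration G | w e])%E) /\
      vanishes_at_infinity G (two_point P)).
Proof.
have cntV : countable [set: V] by exact: vertices_countable.
split=> [emb p p1|perc]; first exact: embedding_percolation.
have lt1 n : 1 - 2 ^- n.+1 < 1 :> R.
  by rewrite ltrBlDr ltrDl invr_gt0 exprn_gt0.
have [P PP] := choice (fun n => perc _ (lt1 n)).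
by apply: (percolation_embedding connG cntV (P := P)) => n; have [] := PP n.
Qed.
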